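(* Let $T\in L(H)$ be an $a$-contraction with $0<a<1$ and let $b>1-a$. Then the following statements are equivalent. (i) The isometry $S$ does not appear in the (minimal) $(1-t)^a$-model of $T$, i.e. $\mathcal{W}=\{0\}$ in that model. (ii) For every $x\in H$, the limit $$\lim_{n\to\infty}\frac{1}{k^{b+1}(n)}\sum_{j=0}^nk^b(n-j)\|T^jx\|^2$$ exists and equals $0$. (iii) For every $x\in H$, $\liminf_{n\to\infty}\|T^nx\|=0$.
   Context: Hilbert spaces are separable and complex. The Cesàro numbers $k^{-s}(n)$ ($s\in\mathbb{R}$) are defined by $(1-t)^s=\sum_{n=0}^\infty k^{-s}(n)t^n$, $|t|<1$. Write $\alpha(t)=(1-t)^a=\sum_n\alpha_nt^n$ and $k(t)=(1-t)^{-a}=\sum_nk_nt^n$, $k_n=k^a(n)>0$. $T\in L(H)$ is an $a$-contraction if $\sum_n|\alpha_n|T^{*n}T^n$ converges in the strong operator topology and $\alpha(T^*,T):=\sum_n\alpha_nT^{*n}T^n\ge0$. $\mathcal{H}_k$ is the Hilbert space of power series $f=\sum f_nt^n$ with norm $\big(\sum_n|f_n|^2k_n\big)^{1/2}$, $B_kf(t)=(f(t)-f(0))/t$, and $\mathcal{H}_k\otimes\mathcal{E}$ is the analogous space of $\mathcal{E}$-valued power series, on which $B_k\otimes I_{\mathcal{E}}$ acts by the same formula. For $0<a<1$ every $a$-contraction $T$ has a $(1-t)^a$-model: it is unitarily equivalent to $((B_k\otimes I_{\mathcal{E}})\oplus S)|\mathcal{L}$, where $S$ is an isometry on a Hilbert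 space $\mathcal{W}$ and $\mathcal{L}$ is a closed invariant subspace of $(B_k\otimes I_{\mathcal{E}})\oplus S$. The model is minimal if $\mathcal{L}\not\subset(\mathcal{H}_k\otimes\mathcal{E}')\oplus\mathcal{W}$ for every closed subspace $\mathcal{E}'\subsetneqq\mathcal{E}$ and $\mathcal{L}\not\subset(\mathcal{H}_k\otimes\mathcal{E})\oplus\mathcal{W}'$ for every closed $S$-invariant subspace $\mathcal{W}'\subsetneqq\mathcal{W}$. For $\alpha(t)=(1-t)^a$ the minimal model is unique up to unitary isomorphisms of $\mathcal{E}$ and $\mathcal{W}$. It is given explicitly by $D=(\alpha(T^*,T))^{1/2}$, $\mathcal{E}=\overline{DH}$, $V_Dx=\sum_n(DT^nx)z^n$, $W=(I-V_D^*V_D)^{1/2}$, $\mathcal{W}=\overline{WH}$, $SWx=WTx$, $\mathcal{L}=\operatorname{Ran}(V_D,W)$. *)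

(* Defs.v *)
From HB Require Import structures.
From mathcomp Require Import all_boot all_order all_algebra sesquilinear.
From mathcomp Require Import complex.
From mathcomp Require Import all_classical all_reals all_analysis.

Set Implicit Arguments.
Unset Strict Implicit.
Unset Printing Implicit Defensive.

Import Order.TTheory GRing.Theory Num.Theory.
Import numFieldNormedType.Exports.

Local Open Scope classical_set_scope.
Local Open Scope ring_scope.
Local Open Scope complex_scope.

(* The inner product [hdot] is linear in its first argument and
   conjugate-linear in its second one. *)
HB.mixin Record CompleteNormedModule_isHilbert (R : realType) H
    & CompleteNormedModule R[i] H := {
  hdot : {dot H for (@Num.conj R[i])};
  hdotE : forall x : H, hdot x x = `|x| ^+ 2
}.

#[short(type="hilbertType")]
HB.structure Definition Hilbert (R : realType) :=
  {H of CompleteNormedModule_isHilbert R H & CompleteNormedModule R[i] H}.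

Definition separable_space (T : topologicalType) : Prop :=
  exists2 D : set T, countable D & dense D.

Section Operators.
Context {R : realType} {H : hilbertType R}.

(* The library norm of [H] takes its values in [R[i]]. *)
Definition hnorm (x : H) : R := complex.Re `|x|.

(* For a continuous linear [T], the Riesz theorem provides a unique such
   vector; [0] is an unused default. *)
Definition adjoint (T : H -> H) (y : H) : H :=
  xget 0 [set z | forall x, hdot (T x) y = hdot x z].

(* In [R[i]], [0 <= z] means that [z] is real and nonnegative. *)
Definition positive_operator (A : H -> H) : Prop :=
  forall x, 0 <= hdot (A x) x.

Definition closed_subspace (A : set H) : Prop :=
  [/\ closed A, A 0 & forall (c : R[i]) x y, A x -> A y -> A (c *: x + y)].

End Operators.

(* [cesaro_number s n] is k^s(n): the coefficient of t^n in (1 - t)^(-s). *)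
Definition cesaro_number (R : realType) (s : R) : R^nat :=
  xget (fun=> 0) [set c : R^nat | forall t : R, `|t| < 1 ->
    series (fun n => c n * t ^+ n) @ \oo --> (1 - t) `^ (- s)].

Section AContractions.
Context {R : realType} {H : hilbertType R}.
Variables (a : R) (T : H -> H).

(* The n-th coefficient of (1 - t)^a is k^(-a)(n). *)
Definition alpha_term (n : nat) (x : H) : H :=
  (cesaro_number (- a) n)%:C *: iter n (adjoint T) (iter n T x).

Definition alpha_abs_term (n : nat) (x : H) : H :=
  `|cesaro_number (- a) n|%:C *: iter n (adjoint T) (iter n T x).

Definition alpha_op (x : H) : H := limn (series (fun n => alpha_term n x)).

Definition a_contraction : Prop :=
  (forall x, cvgn (series (fun n => alpha_abs_term n x)))
  /\ positive_operator alpha_op.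

End AContractions.

Section ModelSpace.
Context {R : realType} {E W : hilbertType R}.
Variable k : R^nat.

(* A power series with coefficients in [E] is represented by its sequence of
   coefficients; it belongs to H_k (x) E when [hk_norm2] is finite. *)
Definition hk_norm2 (f : nat -> E) : \bar R :=
  (\sum_(0 <= n <oo) (k n * hnorm (f n) ^+ 2)%:E)%E.

Definition backward_shift (f : nat -> E) : nat -> E := fun n => f n.+1.

Definition model_norm2 (u : (nat -> E) * W) : \bar R :=
  (hk_norm2 u.1 + (hnorm u.2 ^+ 2)%:E)%E.

Definition model_space : set ((nat -> E) * W) :=
  [set u | (model_norm2 u < +oo)%E].

Definition model_operator (S : W -> W) (u : (nat -> E) * W) :
    (nat -> E) * W :=
  (backward_shift u.1, S u.2).

(* Closedness is sequential, for the norm of (H_k (x) E) (+) W. *)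
Definition model_closed_subspace (L : set ((nat -> E) * W)) : Prop :=
  [/\ L `<=` model_space,
      L 0,
      forall (c : R[i]) u v, L u -> L v -> L (c *: u + v) &
      forall (u_ : nat -> (nat -> E) * W) (u : (nat -> E) * W),
        (forall n, L (u_ n)) -> model_space u ->
        (fun n => model_norm2 (u_ n - u)) @ \oo --> 0%E -> L u].

End ModelSpace.

(* [model_unitary] maps H isometrically onto the subspace and intertwines [T]
   with the restriction of (B_k (x) I) (+) S. *)
Record model (R : realType) (H : hilbertType R) (a : R) (T : H -> H) := Model {
  model_E : hilbertType R;
  model_W : hilbertType R;
  model_S : {linear model_W -> model_W};
  model_L : set ((nat -> model_E) * model_W);
  model_unitary : {linear H -> ((nat -> model_E) * model_W)%type};
  model_E_separable : separable_space model_E;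
  model_W_separable : separable_space model_W;
  model_S_isometry : forall w, hnorm (model_S w) = hnorm w;
  model_L_closed : model_closed_subspace (cesaro_number a) model_L;
  model_L_invariant : forall u, model_L u -> model_L (model_operator model_S u);
  model_unitary_range : range model_unitary = model_L;
  model_unitary_norm : forall x,
    model_norm2 (cesaro_number a) (model_unitary x) = (hnorm x ^+ 2)%:E;
  model_unitary_intertwines : forall x,
    model_unitary (T x) = model_operator model_S (model_unitary x)
}.

Arguments model_L {R H a T} m _ : rename.
Arguments model_S {R H a T} m : rename.
Arguments model_unitary {R H a T} m : rename.

Definition minimal_model (R : realType) (H : hilbertType R) (a : R)
    (T : H -> H) (M : model a T) : Prop :=
  (forall E' : set (model_E M), closed_subspace E' -> E' <> setT ->
     ~ model_L M `<=` [set u | forall n, E' (u.1 n)])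
  /\
  (forall W' : set (model_W M), closed_subspace W' ->
     (forall w, W' w -> W' (model_S M w)) -> W' <> setT ->
     ~ model_L M `<=` [set u | W' u.2]).

(* The minimal model being unique up to unitary isomorphisms, a property of
   "the" minimal model is required of all of them, and one of them must exist. *)
Definition isometry_absent (R : realType) (H : hilbertType R) (a : R)
    (T : H -> H) : Prop :=
  (exists M : model a T, minimal_model M) /\
  (forall M : model a T, minimal_model M -> [set: model_W M] = [set 0]).

(* Main.v *)
(** Write q(n) = |T^n x|^2, k_n = k^a(n), alpha_n = k^(-a)(n): then alpha_0 = 1,
   alpha_n < 0 for n > 0, (k_n) decreases, and the convolution k * alpha is the
   unit. Let A = alpha(T^*, T), so that d(n) = <A T^n x, T^n x> is the sum over
   m of alpha_m q(n+m).

   (i) => (ii): with W = 0 one has q(j) = sum_n k_n |f_(n+j)|^2, so that the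
   Cesaro mean of q is sum_m |f_m|^2 K(m, n) / k^(b+1)(n), where
   K(m, n) = sum_(j <= m, n) k^b(n-j) k^a(m-j) is at most C k^(b+1)(n) k^a(m);
   for m = n this is the estimate that needs b > 1 - a.

   (ii) => (iii): if q >= e > 0 eventually, its Cesaro means stay away from 0.

   (iii) => (i): in any model the W-component of T^n x has the norm of that of x
   and is bounded by |T^n x|, so it vanishes, and W = 0 by minimality. For the
   existence of a minimal model, truncating d(n) by the signs of alpha shows
   that w(x) = q(0) - sum_n k_n d(n) satisfies 0 <= w(x) <= w(T x), hence
   w(x) <= q(n) for all n and w(x) = 0. So x |-> (A^(1/2) T^n x)_n is an isometry
   into H_k (x) E, where E is the closure of the range of A^(1/2). *)
From HB Require Import structures.
Require Import Defs.
From mathcomp Require Import all_boot all_order all_algebra.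
From mathcomp Require Import sesquilinear ring lra.
From mathcomp Require Import complex.
From mathcomp Require Import all_classical all_reals all_analysis.
Set Implicit Arguments.
Unset Strict Implicit.
Unset Printing Implicit Defensive.
Import Order.TTheory GRing.Theory Num.Theory.
Import numFieldNormedType.Exports.
Local Open Scope classical_set_scope.
Local Open Scope ring_scope.

(** * The Cesaro numbers *)

Section CesaroCoefficients.
Context {R : realType}.
Implicit Types (s u t : R) (n : nat).

(** The generalized binomial coefficient s (s + 1) ... (s + n - 1) / n!, a closed form of k^s(n);
    [cesaro_numberE] identifies the two. *)
Definition cesaro_coef s n : R := \prod_(i < n) ((s + i%:R) / i.+1%:R).

Lemma cesaro_coef0 s : cesaro_coef s 0 = 1.
Proof. by rewrite /cesaro_coef big_ord0. Qed.

Lemma cesaro_coefS s n :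
  cesaro_coef s n.+1 = cesaro_coef s n * ((s + n%:R) / n.+1%:R).
Proof. by rewrite /cesaro_coef big_ord_recr. Qed.

Lemma cesaro_coefSM s n :
  n.+1%:R * cesaro_coef s n.+1 = (s + n%:R) * cesaro_coef s n.
Proof.
have n0 : n.+1%:R != 0 :> R by rewrite pnatr_eq0.
by rewrite cesaro_coefS mulrC -mulrA divfK// mulrC.
Qed.

(** Both sides are s (s + 1) ... (s + n) / n!. *)
Lemma cesaro_coef_shift s n :
  s * cesaro_coef (s + 1) n = (s + n%:R) * cesaro_coef s n.
Proof.
elim: n => [|n IH]; first by rewrite !cesaro_coef0 addr0.
rewrite !cesaro_coefS mulrA IH -!natr1; field.
by rewrite natr1 pnatr_eq0.
Qed.

(** Coefficient form of (1 - t) (1 - t)^(-s-1) = (1 - t)^(-s). *)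
Lemma cesaro_coef_diff s n :
  cesaro_coef (s + 1) n.+1 - cesaro_coef (s + 1) n = cesaro_coef s n.+1.
Proof.
rewrite !cesaro_coefS (_ : cesaro_coef s n * _ = ((s + n%:R) * cesaro_coef s n) /
  n.+1%:R); last by ring.
rewrite -cesaro_coef_shift -natr1; field.
by rewrite natr1 pnatr_eq0.
Qed.

Lemma cesaro_coef_sum s n :
  \sum_(i < n.+1) cesaro_coef s i = cesaro_coef (s + 1) n.
Proof.
elim: n => [|n IH]; first by rewrite big_ord_recl big_ord0 !cesaro_coef0 addr0.
by rewrite big_ord_recr /= IH -cesaro_coef_diff addrC subrK.
Qed.

(** Vandermonde's identity, that is (1 - t)^(-s) (1 - t)^(-u) = (1 - t)^(-s-u). In the induction the
    factor n + 1 is split as i + (n + 1 - i); [cesaro_coefSM] absorbs each weight, which leaves s +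
    u + n times the previous sum. *)
Lemma cesaro_coef_conv s u n :
  \sum_(i < n.+1) cesaro_coef s i * cesaro_coef u (n - i)%N
  = cesaro_coef (s + u) n.
Proof.
elim: n => [|n IH].
  by rewrite big_ord_recl big_ord0 /= subnn !cesaro_coef0 mulr1 addr0.
have n0 : n.+1%:R != 0 :> R by rewrite pnatr_eq0.
apply: (mulfI n0); rewrite cesaro_coefSM -IH mulr_sumr.
have -> : \sum_(i < n.+2) n.+1%:R * (cesaro_coef s i * cesaro_coef u (n.+1 - i)%N)
   = \sum_(i < n.+2) (i%:R * cesaro_coef s i) * cesaro_coef u (n.+1 - i)%N
   + \sum_(i < n.+2) cesaro_coef s i * ((n.+1 - i)%:R * cesaro_coef u (n.+1 - i)%N).
  rewrite -big_split /=; apply: eq_bigr => i _.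
  have -> : n.+1%:R = i%:R + (n.+1 - i)%:R :> R.
    by rewrite -natrD subnKC// -ltnS.
  ring.
rewrite big_ord_recl /= mul0r mul0r add0r.
rewrite [X in _ + X]big_ord_recr /= subnn mul0r mulr0 addr0.
rewrite mulr_sumr -big_split /=; apply: eq_bigr => i _.
rewrite /bump /= add1n subSS cesaro_coefSM.
have le_in : (i <= n)%N by rewrite -ltnS.
have -> : n%:R = i%:R + (n - i)%:R :> R by rewrite -natrD subnKC.
rewrite subSn// cesaro_coefSM; ring.
Qed.

Lemma cesaro_coef0r n : cesaro_coef 0 n = (n == 0)%:R.
Proof.
case: n => [|n]; first by rewrite cesaro_coef0.
by rewrite /cesaro_coef big_ord_recl add0r !mul0r.
Qed.

Lemma cesaro_coefN1 n : cesaro_coef (-1) n.+2 = 0.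
Proof.
elim: n => [|n IH]; last by rewrite cesaro_coefS IH mul0r.
by rewrite !cesaro_coefS addNr mul0r mulr0.
Qed.

Lemma cesaro_coef_gt0 s n : 0 < s -> 0 < cesaro_coef s n.
Proof.
by move=> s0; apply: prodr_gt0 => i _; rewrite divr_gt0// ltr_wpDr.
Qed.

Lemma cesaro_coef_ge0 s n : 0 <= s -> 0 <= cesaro_coef s n.
Proof.
by move=> s0; apply: prodr_ge0 => i _; rewrite divr_ge0// addr_ge0.
Qed.

Lemma cesaro_coef_lt0 s n : -1 < s < 0 -> cesaro_coef s n.+1 < 0.
Proof.
move=> /andP[s1 s0]; elim: n => [|n IH].
  by rewrite cesaro_coefS cesaro_coef0 mul1r addr0 divr1.
rewrite cesaro_coefS nmulr_rlt0// divr_gt0//.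
by rewrite -natr1; have := ler0n R n; lra.
Qed.

Lemma nonincreasing_cesaro_coef s : 0 <= s <= 1 ->
  nonincreasing_seq (cesaro_coef s).
Proof.
move=> /andP[s0 s1]; apply/nonincreasing_seqP => n;
  rewrite cesaro_coefS ler_piMr ?cesaro_coef_ge0//.
by rewrite ler_pdivrMr ?ltr0Sn// mul1r -natr1 addrC lerD2l.
Qed.

Lemma nondecreasing_cesaro_coef s : 1 <= s -> nondecreasing_seq (cesaro_coef s).
Proof.
move=> s1; apply/nondecreasing_seqP => n;
  rewrite cesaro_coefS ler_peMr ?cesaro_coef_ge0 ?(le_trans _ s1)//.
by rewrite ler_pdivlMr ?ltr0Sn// mul1r -natr1 addrC lerD2r.
Qed.

Lemma normr_cesaro_coef_le s u n :
  `|s| <= u -> `|cesaro_coef s n| <= cesaro_coef u n.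
Proof.
move=> su; rewrite /cesaro_coef normr_prod; apply: ler_prod => i _.
rewrite normr_ge0 /= normrM normfV (ger0_norm (ler0n _ i.+1)).
rewrite ler_pM2r ?invr_gt0 ?ltr0Sn//.
by rewrite (le_trans (ler_normD _ _))// lerD// ger0_norm.
Qed.

(** Multiplication by 1 - t telescopes a partial sum for exponent m + 1 into the one for exponent m
    minus a nonnegative term, so each step of the induction on [m] costs a factor 1 / (1 - t). *)
Lemma series_cesaro_coef_le (m n : nat) t : 0 <= t < 1 ->
  \sum_(0 <= i < n) cesaro_coef m%:R i * t ^+ i <= (1 - t) ^- m.
Proof.
move=> /andP[t0 t1].
have u0 : 0 < 1 - t by rewrite subr_gt0.
elim: m => [|m IH].
  rewrite expr0 invr1 big_mkord; case: n => [|n]; first by rewrite big_ord0 ler01.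
  rewrite big_ord_recl big1 ?addr0 ?cesaro_coef0 ?mulr1// => i _.
  by rewrite /= cesaro_coef0r mul0r.
apply: le_trans (_ : _ <= (1 - t)^-1 * \sum_(0 <= i < n) cesaro_coef m%:R i * t ^+ i) _.
  rewrite -ler_pdivrMl ?invr_gt0// invrK.
  case: n {IH} => [|n]; first by rewrite !big_nil mulr0.
  have -> : (1 - t) * \sum_(0 <= i < n.+1) cesaro_coef m.+1%:R i * t ^+ i =
     \sum_(0 <= i < n.+1) cesaro_coef m%:R i * t ^+ i
      - cesaro_coef m.+1%:R n * t ^+ n.+1.
    elim: n => [|n IHn]; first by rewrite !big_nat1 !cesaro_coef0 !expr0; ring.
    rewrite !(@big_nat_recr _ _ _ n.+1)//= mulrDr IHn -(cesaro_coef_diff m%:R) natr1.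
    by rewrite !exprS; ring.
  by rewrite gerBl// mulr_ge0 ?exprn_ge0// cesaro_coef_ge0.
by rewrite exprS invfM ler_pM2l ?invr_gt0.
Qed.

Lemma is_cvg_pseries_cesaro_coef s t : `|t| < 1 ->
  cvgn (pseries (cesaro_coef s) t).
Proof.
(* An integer exponent [m] above |s| dominates the coefficients, and its partial sums are bounded by
   [series_cesaro_coef_le]. *)
move=> t1; apply: normed_cvg; pose m := Num.bound `|s|.
have sm : `|s| <= m%:R by rewrite ltW// archi_boundP.
apply: nondecreasing_is_cvgn.
  by apply: nondecreasing_series => n _ _; rewrite normr_ge0.
exists ((1 - `|t|) ^- m) => _ [n _ <-].
apply: le_trans (_ : _ <= \sum_(0 <= i < n) cesaro_coef m%:R i * `|t| ^+ i) _.
  rewrite /series /=; apply: ler_sum => i _;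
    rewrite normrM normrX ler_wpM2r ?exprn_ge0//.
  exact: normr_cesaro_coef_le.
by apply: series_cesaro_coef_le; rewrite normr_ge0.
Qed.

End CesaroCoefficients.

Lemma cvgn_mull (K : numFieldType) (c : K) (u : nat -> K) (l : K) :
  u @ \oo --> l -> (fun n => c * u n) @ \oo --> c * l.
Proof. by move=> ul; apply: cvgM => //; exact: cvg_cst. Qed.

Lemma cvgn_le (K : realType) (u : nat -> K) (l c : K) (N : nat) :
  u @ \oo --> l -> (forall n, (N <= n)%N -> u n <= c) -> l <= c.
Proof.
move=> ul uc; rewrite -(cvg_lim _ ul)//.
by apply: limr_le; [apply/cvg_ex; exists l|exists N].
Qed.

Lemma cvgn_ge (K : realType) (u : nat -> K) (l c : K) (N : nat) :
  u @ \oo --> l -> (forall n, (N <= n)%N -> c <= u n) -> c <= l.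
Proof.
move=> ul uc; rewrite -(cvg_lim _ ul)//.
by apply: limr_ge; [apply/cvg_ex; exists l|exists N].
Qed.

(** * The binomial series and the uniqueness of its coefficients *)

Section BinomialSeries.
Context {R : realType}.
Implicit Types (s u t : R) (n : nat).

Lemma pseries_diffs_cesaro_coef s :
  pseries_diffs (cesaro_coef s) = (fun n => s * cesaro_coef (s + 1) n).
Proof.
by apply/funext => n; rewrite /pseries_diffs cesaro_coefSM cesaro_coef_shift.
Qed.

Let f s t := limn (pseries (cesaro_coef s) t).

Lemma pseriesZ s (c : R^nat) t : pseries (fun n => s * c n) t = (fun n => s *
  pseries c t n).
Proof.
by apply/funext => n; rewrite /pseries /series /= mulr_sumr;
  apply: eq_bigr => i _; rewrite mulrA.
Qed.

Let f_shift s t : `|t| < 1 -> (1 - t) * f (s + 1) t = f s t.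
Proof.
move=> t1; apply/esym/cvg_lim => //.
have H1 := @is_cvg_pseries_cesaro_coef _ (s + 1) _ t1.
(* With the index moved by one, the identity holds exactly between partial sums. *)
rewrite -cvg_shiftS.
rewrite (_ : (fun n => _) = (fun n => pseries (cesaro_coef (s + 1)) t n.+1 - t *
  pseries (cesaro_coef (s + 1)) t n)).
  rewrite mulrBl mul1r; apply: cvgB; first by rewrite cvg_shiftS.
  exact: cvgn_mull.
apply/funext => n; rewrite /pseries /series /=; elim: n => [|n IH].
  by rewrite !big_nat1 big_nil !cesaro_coef0; ring.
rewrite big_nat_recr//= IH (big_nat_recr n.+1)//= (big_nat_recr n)//=
  -(cesaro_coef_diff s).
rewrite !exprS; ring.
Qed.

Let f_derive s t : `|t| < 1 -> is_derive t (1 : R) (f s) (s * f (s + 1) t).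
Proof.
(* Termwise differentiation at [t] asks for a radius [K] beyond |t| at which the series and its
   first two formal derivatives converge. *)
move=> t1; have [K tK K1] : exists2 K, `|t| < K & K < 1.
  by exists ((`|t| + 1) / 2); lra.
have K1' : `|K| < 1 by rewrite ger0_norm// (le_trans _ (ltW tK)).
have -> : s * f (s + 1) t = limn (pseries (pseries_diffs (cesaro_coef s)) t).
  rewrite pseries_diffs_cesaro_coef pseriesZ; apply/esym/cvg_lim => //.
  by apply: cvgn_mull; exact: is_cvg_pseries_cesaro_coef.
have cM u v : cvgn (pseries (fun n => v * cesaro_coef u n) K).
  by rewrite pseriesZ; apply/cvg_ex; eexists; apply: cvgn_mull;
    exact: is_cvg_pseries_cesaro_coef.
apply: (@pseries_snd_diffs _ _ K).
- exact: is_cvg_pseries_cesaro_coef.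
- by rewrite pseries_diffs_cesaro_coef.
- rewrite pseries_diffs_cesaro_coef.
  rewrite (_ : pseries_diffs _ = (fun n => s * (s + 1) * cesaro_coef (s + 1 + 1)
    n)); first exact: cM.
  apply/funext => n; rewrite -mulrA cesaro_coef_shift -cesaro_coefSM /pseries_diffs.
  by rewrite mulrCA.
- by rewrite (lt_le_trans tK)// ler_norm.
Qed.

(** The sum of the series times (1 - x)^s has zero derivative on (-1, 1), hence is constant, and its
    value at 0 is 1. *)
Lemma cvg_binomial_series s t : `|t| < 1 ->
  series (fun n => cesaro_coef s n * t ^+ n) @ \oo --> (1 - t) `^ (- s).
Proof.
move=> t1; suff <- : f s t = (1 - t) `^ (- s) by exact: is_cvg_pseries_cesaro_coef.
pose F x := f s x * expR (s * ln (1 - x)).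
have dF (x : R) : `|x| < 1 -> is_derive x (1 : R) F 0.
  move=> x1; have x0 : 0 < 1 - x by rewrite subr_gt0 (le_lt_trans (ler_norm _)).
  have := f_derive s x1 => fd.
  have l1 := @is_derive1_ln R _ x0.
  have d1 : is_derive x (1 : R) (fun x : R => 1 - x) (-1 : R).
    by apply: is_derive_eq; rewrite add0r mul1r.
  have d2 := @is_derive1_comp _ (@ln R) (fun x : R => 1 - x) x _ _ l1 d1.
  have d3 : is_derive x (1 : R) (fun x : R => s * ln (1 - x)) (s * ((1 - x)^-1 * -1)).
    exact: (@is_deriveZ _ _ _ (@ln R \o (fun x : R => 1 - x)) s x 1 _ d2).
  have d4 := @is_derive1_comp _ (@expR R) (fun x : R => s * ln (1 - x)) x _ _
    (is_derive_expR _) d3.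
  have d5 := is_deriveM fd d4.
  rewrite (_ : F = f s * (expR \o (fun x : R => s * ln (1 - x)))) //.
  (* The two terms of the product rule cancel because [(1 - x) * f (s + 1) x = f s x]. *)
  apply: is_derive_eq; rewrite /GRing.scale /= -(f_shift s x1).
  by field; rewrite gt_eqF.
have F0 : F 0 = 1.
  rewrite /F subr0 ln1 mulr0 expR0 mulr1 /f; apply/cvg_lim => //.
  rewrite -cvg_shiftS.
  rewrite (_ : (fun n => _) = (fun n => 1)); first exact: cvg_cst.
  apply/funext => n; rewrite /pseries /series /= big_nat_recl//= cesaro_coef0
    big1 ?addr0 ?mulr1//.
  by move=> i _; rewrite exprS mul0r mulr0.
have Fc x y : x <= y -> -1 < x -> y < 1 -> F x = F y.
  move=> xy xm yM.
  have df (z : R) : x <= z <= y -> is_derive z (1 : R) F 0.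
    by move=> /andP[? ?]; apply: dF; rewrite ltr_norml; lra.
  have [| |c _] := @MVT_segment _ F (fun=> 0) _ _ xy.
  - by move=> z; rewrite in_itv /= => /andP[/ltW ? /ltW ?]; apply: df; apply/andP.
  - apply: continuous_in_subspaceT => z; rewrite inE /= in_itv /= => /df dz.
    by apply/differentiable_continuous/derivable1_diffP.
  - by rewrite mul0r => /eqP; rewrite subr_eq0 => /eqP.
have {}F0 : F t = 1.
  move: t1; rewrite ltr_norml => /andP[t0 t1].
  by rewrite -F0; case: (leP t 0) => [?|/ltW ?]; [apply: Fc|apply/esym/Fc].
have x0 : 0 < 1 - t by rewrite subr_gt0 (le_lt_trans (ler_norm _)).
rewrite /powR gt_eqF// mulNr expRN -[RHS]mul1r.
by apply: (canRL (mulfK _)); [rewrite gt_eqF ?expR_gt0|exact: F0].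
Qed.

(** By strong induction on the index m: once the earlier coefficients vanish, the tail after m is
    O(t^(m+1)), so |d m| <= C t for all small t > 0. *)
Lemma pseries_eq0 (d : R^nat) :
  (forall t, `|t| < 1 -> pseries d t @ \oo --> (0 : R)) -> d = (fun=> 0).
Proof.
move=> d0.
(* Convergence at t = 1/2 bounds the terms d n / 2^n. *)
have [M M0 dM] : exists2 M, 0 < M & forall n, `|d n| <= M * 2 ^+ n.
  have h1 : `|2^-1 : R| < 1 by rewrite ger0_norm; lra.
  have dc := cvgP _ (d0 _ h1).
  have [M0 [_ HM]] := cvg_seq_bounded (cvgP _ (cvg_series_cvg_0 dc)).
  exists (`|M0| + 1) => [|n]; first by rewrite ltr_wpDl.
  have M01 : M0 < `|M0| + 1 by rewrite (le_lt_trans (ler_norm _))// ltrDl.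
  have /= := HM _ M01 n I.
  by rewrite normrM normrX [`|2^-1|]ger0_norm ?invr_ge0// exprVn ler_pdivrMr ?exprn_gt0.
apply/funext => m; elim/ltn_ind: m => m IH.
apply/eqP; apply: contraT => dm; have {}dm : 0 < `|d m| by rewrite normr_gt0.
pose C := 2 * M * 2 ^+ m.+1.
have C0 : 0 < C by rewrite !mulr_gt0// exprn_gt0.
have key t : 0 < t -> t <= 4^-1 -> `|d m| <= C * t.
  move=> t0 t4.
  have geo N : \sum_(m.+1 <= i < N) (2 * t) ^+ i <= 2 * (2 * t) ^+ m.+1.
    have [Nm|mN] := leqP N m.+1.
      by rewrite big_geq// mulr_ge0// exprn_ge0// mulr_ge0// ltW.
    rewrite -(subnK (ltnW mN)); set k := (N - _)%N; move: (k) => {}k {mN N}.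
    (* The subtracted term makes the bound inductive in [k]; the ratio 2t is at most 1/2 since t <=
       1/4. *)
    suff : \sum_(m.+1 <= i < k + m.+1) (2 * t) ^+ i <= 2 * (2 * t) ^+ m.+1 - 2 *
      (2 * t) ^+ (k + m.+1).
      by move=> /le_trans; apply; rewrite gerBl mulr_ge0// exprn_ge0// mulr_ge0// ltW.
    elim: k => [|k IHk]; first by rewrite add0n big_geq// subrr.
    rewrite addSn big_nat_recr ?leq_addl//=.
    have x0 : 0 <= (2 * t) ^+ (k + m.+1) by rewrite exprn_ge0// mulr_ge0// ltW.
    rewrite (le_trans (lerD IHk (lexx _)))// [X in _ <= _ - 2 * X]exprS.
    have := mulr_ge0 x0 (_ : 0 <= 1 - 4 * t); lra.
  rewrite -(ler_pM2r (exprn_gt0 m t0)).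
  have -> : C * t * t ^+ m = M * (2 * (2 * t) ^+ m.+1) by rewrite /C exprMn
    (exprS t); ring.
  have t1 : `|t| < 1 by rewrite gtr0_norm; lra.
  rewrite -[leRHS]add0r.
  have cv : (fun n => `|pseries d t n| + M * (2 * (2 * t) ^+ m.+1)) @ \oo --> 0 +
    M * (2 * (2 * t) ^+ m.+1).
    apply: cvgD; last exact: cvg_cst.
    by rewrite -[X in _ --> X](normr0 R); apply: cvg_norm; exact: d0.
  rewrite -(cvg_lim _ cv)//; apply: limr_ge; first by apply/cvg_ex; eexists; exact: cv.
  exists m.+1 => // N /= mN.
  have -> : `|d m| * t ^+ m = `|pseries d t N - \sum_(m.+1 <= i < N) d i * t ^+ i|.
    rewrite /pseries /series /= (big_cat_nat _ mN)//= addrK big_nat_recr//=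
      big_nat big1 ?add0r.
      by rewrite normrM normrX (gtr0_norm t0).
    by move=> i /andP[_ im]; rewrite IH// mul0r.
  rewrite (le_trans (ler_normB _ _))// lerD2l (le_trans (ler_norm_sum _ _ _))//.
  apply: (@le_trans _ _ (\sum_(m.+1 <= i < N) M * (2 * t) ^+ i)).
    apply: ler_sum => i _; rewrite normrM normrX (gtr0_norm t0) exprMn mulrA.
    by rewrite ler_wpM2r// exprn_ge0// ltW.
  by rewrite -mulr_sumr ler_wpM2l// ltW.
(* Small enough for [key] to apply and to give |d m| <= |d m| / 2. *)
pose t := Order.min 4^-1 (`|d m| / (2 * C)).
have t0 : 0 < t by rewrite lt_min invr_gt0 ltr0n /= divr_gt0// mulr_gt0.
have := key t t0; rewrite ge_min lexx => /(_ isT).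
have tl : t <= `|d m| / (2 * C) by rewrite ge_min lexx orbT.
move=> /le_trans/(_ (ler_wpM2l (ltW C0) tl)).
have -> : C * (`|d m| / (2 * C)) = `|d m| / 2 by field; rewrite gt_eqF.
lra.
Qed.

(** The set from which [xget] chooses is nonempty by the binomial series and has one element by
    [pseries_eq0]. *)
Lemma cesaro_numberE s : cesaro_number s = cesaro_coef s.
Proof.
rewrite /cesaro_number; case: xgetP => [c _ /= Hc|/(_ (cesaro_coef s))]; last first.
  by case=> t t1; exact: cvg_binomial_series.
have /funeqP/= H : (fun n => c n - cesaro_coef s n) = (fun=> 0).
  apply: pseries_eq0 => t t1.
  rewrite (_ : pseries _ t = series (fun n => c n * t ^+ n) - series (fun n =>
    cesaro_coef s n * t ^+ n)).
    rewrite -[X in _ --> X](subrr ((1 - t) `^ (- s))).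
    by apply: cvgB; [exact: Hc|exact: cvg_binomial_series].
  apply/funext => n; rewrite fctE /pseries /series /= -sumrB.
  by apply: eq_bigr => i _; rewrite mulrBl.
by apply/funext => n; apply/eqP; rewrite -subr_eq0 H.
Qed.

End BinomialSeries.

(** * Summing the defect *)

(** Regrouping along the antidiagonals l = i + j. *)
Lemma big_ord_triangle (V : nmodType) (F : nat -> nat -> V) n :
  \sum_(i < n) \sum_(j < n - i) F i j = \sum_(l < n) \sum_(i < l.+1) F i (l - i)%N.
Proof.
elim: n => [|n IH]; first by rewrite !big_ord0.
rewrite [in RHS]big_ord_recr -IH /= big_ord_recr /= subSn// subnn big_ord1.
rewrite [X in _ = _ + X]big_ord_recr /= subnn addrA; congr (_ + _).
rewrite -big_split /=; apply: eq_bigr => i _.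
by rewrite subSn ?big_ord_recr// ltnW.
Qed.

Section Defect.
Context {R : realType}.
Variables (a : R) (q d : nat -> R).
Hypotheses (a_gt0 : 0 < a) (a_lt1 : a < 1).
Hypotheses (q_ge0 : forall n, 0 <= q n) (d_ge0 : forall n, 0 <= d n).
Hypothesis d_cvg : forall n,
  series (fun m => cesaro_coef (- a) m * q (n + m)%N) @ \oo --> d n.

Let opp_a : -1 < - a < 0.
Proof. by rewrite ltrN2 a_lt1 oppr_lt0. Qed.

Let a_sub1 : -1 < a - 1 < 0.
Proof. by rewrite ltrBrDr addNr a_gt0 subr_lt0. Qed.

(** The coefficients after the zeroth are negative, so the partial sums decrease to d n as soon as
    they contain the zeroth term; hence the bound [m.+1]. *)
Let defect_le n m : d n <= \sum_(i < m.+1) cesaro_coef (- a) i * q (n + i)%N.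
Proof.
apply: (cvgn_le (N := m.+1) (@d_cvg n)) => N mN.
rewrite /series /= -(subnK mN); elim: (N - m.+1)%N => [|i IH];
  first by rewrite add0n big_mkord.
rewrite addSn big_nat_recr//=; apply: le_trans IH; rewrite gerDl.
by rewrite nmulr_rle0 ?q_ge0// addnS cesaro_coef_lt0.
Qed.

(* By the signs of the coefficients, truncating [d n] to the indices below [N]
   increases it; the truncated double sum is a finite convolution. *)
Lemma series_defect_le N : \sum_(n < N) cesaro_coef a n * d n <= q 0.
Proof.
case: N => [|N]; first by rewrite big_ord0.
apply: (@le_trans _ _ (\sum_(n < N.+1) \sum_(m < N.+1 - n)
    cesaro_coef a n * (cesaro_coef (- a) m * q (n + m)%N))).
  apply: ler_sum => n _; rewrite -mulr_sumr ler_wpM2l ?cesaro_coef_ge0 ?(ltW a_gt0)//.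
  by rewrite subSn ?leq_ord//; exact: defect_le.
rewrite (big_ord_triangle (fun n m => cesaro_coef a n * (cesaro_coef (- a) m * q
  (n + m)%N))).
rewrite (eq_bigr (fun l : 'I_N.+1 => cesaro_coef 0 l * q l)) => [|l _].
  rewrite big_ord_recl /= cesaro_coef0 mul1r big1 ?addr0// => i _.
  by rewrite cesaro_coef0r mul0r.
rewrite (_ : cesaro_coef 0 l = cesaro_coef (a - a) l); last by rewrite subrr.
rewrite -cesaro_coef_conv mulr_suml; apply: eq_bigr => i _.
by rewrite subnKC ?leq_ord// mulrA.
Qed.

(** A truncated form of w(x) <= w(T x). Subtracting the two sums leaves the weights k^(a-1)(n),
    which are negative for n > 0. At n = 0 the weight is 1 and truncation goes the wrong way; its
    error is the last bracket, which tends to 0. *)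
Lemma defect_step N :
  q 0 - \sum_(n < N.+2) cesaro_coef a n * d n
   <= q 1 - \sum_(n < N.+1) cesaro_coef a n * d n.+1
      + (series (fun m => cesaro_coef (- a) m * q m) N.+2 - d 0).
Proof.
rewrite /series /= big_mkord.
have E : \sum_(n < N.+2) cesaro_coef a n * d n - \sum_(n < N.+1) cesaro_coef a n
  * d n.+1
    = \sum_(n < N.+2) cesaro_coef (a - 1) n * d n.
  rewrite !(big_ord_recl N.+1) /= !cesaro_coef0 -addrA -sumrB; congr (_ + _).
  apply: eq_bigr => i _; rewrite /bump /= add1n -(cesaro_coef_diff (a - 1)) subrK.
  by ring.
(* The triangle sum is a convolution with the coefficients of (1 - t)^(1-a) (1 - t)^a = 1 - t. *)
have F : \sum_(n < N.+2) \sum_(m < N.+2 - n) cesaro_coef (a - 1) n * (cesaro_coef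
  (- a) m * q (n + m)%N)
    = q 0 - q 1.
  rewrite (big_ord_triangle (fun n m => cesaro_coef (a - 1) n * (cesaro_coef (-
    a) m * q (n + m)%N))).
  rewrite (eq_bigr (fun l : 'I_N.+2 => cesaro_coef (- 1) l * q l)) => [|l _].
    rewrite !big_ord_recl /= cesaro_coef0 mul1r big1 => [|i _].
      by rewrite /bump /= cesaro_coefS cesaro_coef0; field.
    by rewrite /bump /= !add1n cesaro_coefN1 mul0r.
  rewrite (_ : cesaro_coef (-1) l = cesaro_coef (a - 1 - a) l);
    last by congr cesaro_coef; ring.
  rewrite -cesaro_coef_conv mulr_suml; apply: eq_bigr => i _.
  by rewrite subnKC ?leq_ord// mulrA.
(* Truncation increases [d], and the negative weight reverses the inequality. *)
have G : \sum_(n < N.+1) cesaro_coef (a - 1) n.+1 * (\sum_(m < N.+1 - n)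
  (cesaro_coef (- a) m * q (n.+1 + m)%N))
    <= \sum_(n < N.+1) cesaro_coef (a - 1) n.+1 * d n.+1.
  apply: ler_sum => n _; rewrite ler_nM2l ?cesaro_coef_lt0//.
  by rewrite subSn ?leq_ord//; exact: defect_le.
have recl (V : nmodType) (u : nat -> V) : \sum_(n < N.+2) u n = u 0 + \sum_(n <
  N.+1) u n.+1.
  by rewrite big_ord_recl.
rewrite big_ord_recl subn0 cesaro_coef0 -mulr_sumr mul1r in F.
rewrite (eq_bigr (fun n : 'I_N.+1 => cesaro_coef (a - 1) n.+1 *
   (\sum_(m < N.+1 - n) (cesaro_coef (- a) m * q (n.+1 + m)%N)))) in F; last first.
  by move=> n _; rewrite mulr_sumr.
rewrite (recl _ (fun n => cesaro_coef (a - 1) n * d n)) cesaro_coef0 in E.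
rewrite (eq_bigr (fun m : 'I_N.+2 => cesaro_coef (- a) m * q m)) // in F.
move: E F G; rewrite mul1r => E F G; lra.
Qed.

Lemma is_cvg_series_defect : cvgn (series (fun n => cesaro_coef a n * d n)).
Proof.
apply: nondecreasing_is_cvgn.
  by apply: nondecreasing_series => n _ _;
    rewrite mulr_ge0 ?d_ge0// cesaro_coef_ge0// ltW.
by exists (q 0) => _ [n _ <-]; rewrite /series /= big_mkord series_defect_le.
Qed.

End Defect.

(** The limit of [defect_step] in [N]; its last bracket vanishes because the series of d 0 converges
    to d 0. *)
Lemma defect_le_next (R : realType) (a : R) (q d : nat -> R) :
  0 < a -> a < 1 -> (forall n, 0 <= q n) -> (forall n, 0 <= d n) ->
  (forall n, series (fun m => cesaro_coef (- a) m * q (n + m)%N) @ \oo --> d n) ->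
  q 0 - limn (series (fun n => cesaro_coef a n * d n)) <=
  q 1 - limn (series (fun n => cesaro_coef a n * d n.+1)).
Proof.
move=> a0 a1 q0 d0 dc.
have c0 := is_cvg_series_defect a0 a1 q0 d0 dc.
have dc1 n : series (fun m => cesaro_coef (- a) m * q (n + m).+1) @ \oo --> d
  n.+1 by exact: (dc n.+1).
have c1 := @is_cvg_series_defect _ _ (fun n => q n.+1) (fun n => d n.+1) a0 a1
  (fun n => q0 n.+1) (fun n => d0 n.+1) dc1.
set l0 := limn _; set l1 := limn _.
have cl0 : (fun N => series (fun n => cesaro_coef a n * d n) N.+2) @ \oo --> l0.
  by rewrite (cvg_shiftS (fun N => series _ N.+1)) cvg_shiftS.
have cl1 : (fun N => series (fun n => cesaro_coef a n * d n.+1) N.+1) @ \oo --> l1.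
  by rewrite cvg_shiftS.
have cd : (fun N => series (fun m => cesaro_coef (- a) m * q m) N.+2) @ \oo --> d 0.
  by rewrite (cvg_shiftS (fun N => series _ N.+1)) cvg_shiftS; exact: (dc 0).
have cv : (fun N => q 1 - series (fun n => cesaro_coef a n * d n.+1) N.+1 +
     (series (fun m => cesaro_coef (- a) m * q m) N.+2 - d 0) -
     (q 0 - series (fun n => cesaro_coef a n * d n) N.+2)) @ \oo -->
    q 1 - l1 + (d 0 - d 0) - (q 0 - l0).
  apply: cvgB; first apply: cvgD.
  - by apply: cvgB; [exact: cvg_cst|].
  - by apply: cvgB; [|exact: cvg_cst].
  - by apply: cvgB; [exact: cvg_cst|].
rewrite -subr_ge0 -[q 1 - l1]addr0 -[X in q 1 - l1 + X](subrr (d 0)).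
apply: (cvgn_ge (N := 0) cv) => N _; rewrite subr_ge0.
by have := defect_step a0 a1 q0 dc N; rewrite /series /= !big_mkord.
Qed.

(* The defect [q 0 - \sum_n k_n (d n)] grows along shifts of [q] while staying
   below [q], so it vanishes as soon as [q] has arbitrarily small values. *)
Lemma cvg_series_defect (R : realType) (a : R) (q d : nat -> R) :
  0 < a -> a < 1 -> (forall n, 0 <= q n) -> (forall n, 0 <= d n) ->
  (forall n, series (fun m => cesaro_coef (- a) m * q (n + m)%N) @ \oo --> d n) ->
  (forall e, 0 < e -> exists n, q n < e) ->
  series (fun n => cesaro_coef a n * d n) @ \oo --> q 0.
Proof.
move=> a0 a1 q0 d0 dc qinf.
have c0 := is_cvg_series_defect a0 a1 q0 d0 dc.
suff <- : limn (series (fun n => cesaro_coef a n * d n)) = q 0 by [].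
apply/eqP; rewrite eq_le; apply/andP; split.
  apply: (cvgn_le (N := 0) c0) => n _.
  by rewrite /series /= big_mkord; exact: series_defect_le.
(* [defect_le_next] is applied to the successive shifts of [q] and [d]. *)
have shift j : q 0 - limn (series (fun n => cesaro_coef a n * d n)) <=
   q j - limn (series (fun n => cesaro_coef a n * d (j + n)%N)).
  elim: j => [|j IH]; first by [].
  apply: (le_trans IH).
  have := @defect_le_next _ a (fun n => q (j + n)%N) (fun n => d (j + n)%N) a0 a1.
  rewrite addn0 addn1 (_ : (fun n => cesaro_coef a n * d (j + n.+1)%N) = (fun n
    => cesaro_coef a n * d (j.+1 + n)%N)).
    apply=> // n; under eq_fun do rewrite addnA; exact: dc.
  by apply/funext => n; rewrite addnS addSn.
rewrite -subr_le0; apply/ler_addgt0Pr => e e0; rewrite add0r.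
have [j qj] := qinf _ e0; apply: le_trans (ltW qj); apply: le_trans (shift j) _.
rewrite gerBl; have := @is_cvg_series_defect _ a (fun n => q (j + n)%N) (fun n =>
  d (j + n)%N) a0 a1.
move=> c; apply: limr_ge.
  by apply: c => // n; under eq_fun do rewrite addnA; exact: dc.
apply: nearW => n; rewrite /series /= sumr_ge0// => i _.
by rewrite mulr_ge0 ?d0// cesaro_coef_ge0// ltW.
Qed.

(** * Cesaro means *)

Section CesaroKernel.
Context {R : realType}.
Variables (a b : R).
Hypotheses (a_gt0 : 0 < a) (a_lt1 : a < 1) (b_gt : 1 - a < b).
Implicit Types m n p : nat.

Let b_gt0 : 0 < b. Proof. by rewrite (lt_trans _ b_gt)// subr_gt0. Qed.

Let b1_gt0 : 0 < b + 1. Proof. by rewrite addr_gt0. Qed.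

Let a_ge0 : 0 <= a. Proof. exact: ltW. Qed.

Let b_ge0 : 0 <= b. Proof. exact: ltW. Qed.

Let b1_ge1 : 1 <= b + 1. Proof. by rewrite lerDr. Qed.

Let c_gt0 (s : R) n : 0 < s -> 0 < cesaro_coef s n := @cesaro_coef_gt0 R s n.

Let c_ge0 (s : R) n : 0 < s -> 0 <= cesaro_coef s n.
Proof. by move=> s0; rewrite cesaro_coef_ge0// ltW. Qed.

(** The kernel K(n + p, n), indexed by i = n - j, at distance p from the diagonal. *)
Let diag n p := \sum_(i < n.+1) cesaro_coef b i * cesaro_coef a (i + p)%N.

(* Along a diagonal, the increments of [C k^(b+1)(n) k^a(n+p)] dominate those of
   [diag n p] once [C (b - (1 - a) (n + 1) / (n + a)) >= b], which is possible for
   large [n] because [b > 1 - a]. *)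
Let diag_step (C : R) n p :
  diag n p <= C * (cesaro_coef (b + 1) n * cesaro_coef a (n + p)%N) ->
  0 <= C ->
  b <= C * (b - (1 - a) * (n.+1%:R / (n%:R + a))) ->
  diag n.+1 p <= C * (cesaro_coef (b + 1) n.+1 * cesaro_coef a (n.+1 + p)%N).
Proof.
move=> IH C0 bC; rewrite /diag big_ord_recr /=.
set X := cesaro_coef (b + 1) n.+1; set Y := cesaro_coef a (n.+1 + p)%N.
have X0 : 0 < X by exact: c_gt0.
have Y0 : 0 < Y by exact: c_gt0.
have n0 := ler0n R n; have p0 := ler0n R p.
set N := n%:R in bC n0; set P : R := p%:R in p0.
have bn : 0 < b + N + 1 by rewrite addr_gt0// ltr_wpDr.
have an : 0 < a + N + P by rewrite ltr_wpDr// ltr_wpDr.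
have an' : 0 < N + a by rewrite ltr_wpDl.
(* All coefficients are expressed through [X] and [Y], so that the product X Y cancels from both
   sides. *)
have E1 : cesaro_coef b n.+1 = b / (b + N + 1) * X.
  have := cesaro_coef_shift b n.+1; rewrite -/X -natr1 -/N addrA => E.
  by rewrite mulrAC E mulrC mulKf ?gt_eqF.
have E2 : cesaro_coef (b + 1) n = (N + 1) / (b + N + 1) * X.
  have := cesaro_coefSM (b + 1) n; rewrite -/X -natr1 -/N addrAC => E.
  by rewrite mulrAC E mulrC mulKf ?gt_eqF.
have E3 : cesaro_coef a (n + p) = (N + P + 1) / (a + N + P) * Y.
  have := cesaro_coefSM a (n + p);
    rewrite -addSn -/Y addSn -natr1 natrD -/N -/P addrA => E.
  by rewrite mulrAC E mulrC mulKf ?gt_eqF.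
rewrite E1; move: IH; rewrite E2 E3 -/(diag n p) => IH.
apply: le_trans (lerD IH (lexx _)) _.
have -> : C * ((N + 1) / (b + N + 1) * X * ((N + P + 1) / (a + N + P) * Y)) + b /
  (b + N + 1) * X * Y
   = (C * ((N + 1) * ((N + P + 1) / (a + N + P))) + b) / (b + N + 1) * (X * Y).
  by field; rewrite !gt_eqF.
rewrite ler_pM2r ?mulr_gt0// ler_pdivrMr//.
have -> : (N + P + 1) / (a + N + P) = 1 + (1 - a) / (a + N + P).
  by field; rewrite gt_eqF.
(* The worst case is p = 0, which makes the condition on [C] independent of [p]. *)
have h : (N + 1) * ((1 - a) / (a + N + P)) <= (1 - a) * ((N + 1) / (N + a)).
  rewrite mulrCA ler_wpM2l ?subr_ge0 ?(ltW a_lt1)// ler_wpM2l ?addr_ge0//.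
  by rewrite lef_pV2 ?posrE// (addrC N) lerDl.
move: bC; rewrite -natr1 -/N.
have := ler_wpM2l C0 h.
move: ((1 - a) * ((N + 1) / (N + a))) ((1 - a) / (a + N + P)) => u v.
by rewrite !mulrDr !mulrA !mulr1 => h1; rewrite mulrN; lra.
Qed.

(** Treats the finitely many small n to which [diag_step] does not apply, with a constant uniform in
    p. *)
Let diag_finite N : exists2 C, 0 <= C & forall n p, (n <= N)%N ->
  diag n p <= C * (cesaro_coef (b + 1) n * cesaro_coef a (n + p)%N).
Proof.
elim: N => [|N [C C0 IH]].
  exists 1 => // n p; rewrite leqn0 => /eqP ->.
  by rewrite /diag big_ord_recl big_ord0 /= addr0 !cesaro_coef0 !mul1r.
(* The old terms lose at most a factor 1/a, since k^a(n+1) / k^a(n) = (a + n) / (n + 1) >= a; the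
   new term adds 1, since k^b <= k^(b+1). *)
exists (C / a + 1) => [|n p].
  by rewrite addr_ge0// divr_ge0// ltW.
rewrite leq_eqVlt => /predU1P[->|]; last first.
  rewrite ltnS => /(IH _ p) /le_trans; apply.
  rewrite ler_wpM2r ?mulr_ge0 ?c_ge0// (@le_trans _ _ (C / a))// ?lerDl//.
  by rewrite ler_peMr// invf_ge1// ltW.
rewrite /diag big_ord_recr /= -/(diag N p) mulrDl mul1r lerD//.
  apply: le_trans (IH N p (leqnn _)) _.
  rewrite -mulrA ler_wpM2l// mulrCA ler_pM ?c_ge0//.
    exact: nondecreasing_cesaro_coef.
  rewrite mulrC ler_pdivlMr// addSn mulrC.
  have := cesaro_coefSM a (N + p) => E.
  rewrite cesaro_coefS mulrC ler_wpM2l ?c_ge0//.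
  rewrite ler_pdivlMr ?ltr0Sn// -natr1 mulrDr mulr1 addrC lerD2l.
  by rewrite ler_piMl ?ler0n// ltW.
rewrite ler_pM2r ?c_gt0// -(cesaro_coef_diff b) gerBl ltW// c_gt0//.
Qed.

Let diag_le : exists2 C, 0 <= C & forall n p,
  diag n p <= C * (cesaro_coef (b + 1) n * cesaro_coef a (n + p)%N).
Proof.
pose rho := b - (1 - a); have rho0 : 0 < rho by rewrite subr_gt0.
(* For n > 2 / rho the bracket rho - (1 - a)^2 / (n + a) of [diag_step] is at least rho / 2, so the
   constant 2 b / rho satisfies its condition. *)
pose N := Num.bound (2 / rho).
have HN : 2 / rho < N%:R by rewrite archi_boundP// divr_ge0// ltW.
have [C C0 HC] := diag_finite N.
exists (Num.max C (2 * b / rho)) => [|n p]; first by rewrite le_max C0.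
have [nN|/ltnW] := leqP n N.
  apply: le_trans (HC n p nN) _.
  by rewrite ler_wpM2r ?mulr_ge0 ?c_ge0// le_max lexx.
move=> Nn; rewrite -(subnK Nn); elim: (n - N)%N => [|i IH].
  rewrite add0n; apply: le_trans (HC N p (leqnn _)) _.
  by rewrite ler_wpM2r ?mulr_ge0 ?c_ge0// le_max lexx.
rewrite addSn; apply: diag_step => //; first by rewrite le_max C0.
set M : R := (i + N)%:R.
have M0 : 2 / rho < M by rewrite (lt_le_trans HN)// ler_nat leq_addl.
have Mp : 0 < M by rewrite (le_lt_trans _ M0)// divr_ge0// ltW.
have h : rho / 2 <= b - (1 - a) * ((i + N).+1%:R / (M + a)).
  rewrite -[(i + N).+1%:R]natr1 -/M.
  have -> : b - (1 - a) * ((M + 1) / (M + a)) = rho - (1 - a) ^+ 2 / (M + a).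
    have : M + a != 0 by rewrite gt_eqF ?addr_gt0.
    by rewrite /rho; move: M {M0 Mp} => M Ma; field.
  suff : (1 - a) ^+ 2 / (M + a) <= rho / 2 by lra.
  rewrite ler_pdivrMr ?addr_gt0//.
  have h1 : 2 < M * rho by rewrite -ltr_pdivrMr.
  have h2 : (1 - a) ^+ 2 <= 1 by rewrite expr_le1// ?subr_ge0 ?gerBl// ltW.
  have h3 : 0 <= rho * a by rewrite mulr_ge0// ltW.
  by move: h1 h2 h3; move: (M) (rho) => ? ?; lra.
apply: (@le_trans _ _ (2 * b / rho * (rho / 2))).
  have -> : 2 * b / rho * (rho / 2) = b by field; rewrite gt_eqF.
  by [].
rewrite ler_pM// ?divr_ge0 ?mulr_ge0// ?(ltW rho0)//.
by rewrite le_max lexx orbT.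
Qed.

Definition cesaro_kernel m n :=
  \sum_(j < n.+1 | (j <= m)%N) cesaro_coef b (n - j) * cesaro_coef a (m - j).

Let kernel_lt m n : (m < n)%N ->
  cesaro_kernel m n = \sum_(j < m.+1) cesaro_coef b (n - j) * cesaro_coef a (m - j).
Proof.
move=> mn; rewrite [RHS](big_ord_widen n.+1 (fun j => cesaro_coef b (n - j) *
  cesaro_coef a (m - j)))//.
by rewrite ltnS ltnW.
Qed.

Let kernel_ge m n : (n <= m)%N -> cesaro_kernel m n = diag n (m - n).
Proof.
move=> nm; rewrite /diag /cesaro_kernel [RHS](reindex_inj rev_ord_inj) /=.
rewrite big_mkcond /=; apply: eq_bigr => j _; rewrite subSS.
have jn : (j <= n)%N by rewrite -ltnS.
by rewrite (leq_trans jn nm) [((n - j) + _)%N]addnC addnBA// subnK.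
Qed.

(** For n <= m this is [diag_le]. For m < n the argument depends on whether k^b increases (b >= 1)
    or decreases (b < 1). *)
Lemma cesaro_kernel_le : exists2 C, 0 <= C & forall m n,
  cesaro_kernel m n <= C * (cesaro_coef (b + 1) n * cesaro_coef a m).
Proof.
have [C C0 HC] := diag_le.
exists (Num.max C (b / a)) => [|m n]; first by rewrite le_max C0.
have pos : 0 <= cesaro_coef (b + 1) n * cesaro_coef a m by rewrite mulr_ge0 ?c_ge0.
have [nm|mn] := leqP n m.
  rewrite kernel_ge//; apply: le_trans (HC n (m - n)%N) _.
  by rewrite subnKC// ler_wpM2r// le_max lexx.
rewrite kernel_lt//; have [b1|b1] := leP 1 b.
  (* Bounding k^b(n-j) by k^b(n) leaves k^b(n) k^(a+1)(m). The constant b / a comes from a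
     k^(a+1)(m) = (a + m) k^a(m), b k^(b+1)(n) = (b + n) k^b(n) and a + m <= b + n. *)
  apply: (@le_trans _ _ (b / a * (cesaro_coef (b + 1) n * cesaro_coef a m)));
    last first.
    by rewrite ler_wpM2r// le_max lexx orbT.
  apply: (@le_trans _ _ (\sum_(j < m.+1) cesaro_coef b n * cesaro_coef a (m - j))).
    apply: ler_sum => j _; rewrite ler_wpM2r ?c_ge0//.
    exact: (nondecreasing_cesaro_coef b1 (leq_subr _ _)).
  rewrite -mulr_sumr (reindex_inj rev_ord_inj) /=.
  under eq_bigr do rewrite subSS subKn ?leq_ord//.
  rewrite cesaro_coef_sum mulrAC ler_pdivlMr//.
  have := cesaro_coef_shift a m; have := cesaro_coef_shift b n => E1 E2.
  have -> : cesaro_coef b n * cesaro_coef (a + 1) m * a = (a + m%:R) *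
    cesaro_coef b n * cesaro_coef a m.
    by rewrite -mulrA (mulrC _ a) E2 mulrCA mulrA.
  rewrite mulrA E1.
  rewrite ler_wpM2r ?c_ge0//.
  rewrite ler_wpM2r ?c_ge0//.
  by rewrite lerD ?ler_nat ?(ltnW mn)// (le_trans (ltW a_lt1)).
(* As k^b decreases, replacing n by m increases each term and leads back to the diagonal. *)
apply: (@le_trans _ _ (diag m 0)).
  rewrite -[X in diag m X](subnn m) -kernel_ge// /cesaro_kernel [leRHS]big_mkcond /=.
  apply: ler_sum => j _; rewrite leq_ord ler_wpM2r ?c_ge0//.
  by apply: nonincreasing_cesaro_coef; rewrite ?b_ge0 ?(ltW b1)// leq_sub2r// ltnW.
apply: le_trans (HC m 0%N) _; rewrite addn0 ler_pM ?mulr_ge0 ?c_ge0//.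
  by rewrite le_max lexx.
rewrite ler_wpM2r ?c_ge0//.
by apply: nondecreasing_cesaro_coef => //; exact: ltnW.
Qed.

(** For fixed m the kernel has m + 1 terms, each at most k^b(i) with i = n - j, and k^b(i) /
    k^(b+1)(i) = b / (b + i) tends to 0. *)
Lemma cvg_cesaro_kernel m :
  (fun n => (cesaro_coef (b + 1) n)^-1 * cesaro_kernel m n) @ \oo --> (0 : R).
Proof.
(* The shift puts every index in the range m < n and gives i >= n + 1 below. *)
rewrite -(cvg_shiftn m.+1).
have cv : (fun n : nat => (m.+1%:R * b) * n.+1%:R^-1) @ \oo --> (0 : R).
  by rewrite -[X in _ --> X](mulr0 (m.+1%:R * b)); apply: cvgn_mull;
    exact: cvg_harmonic.
apply: (squeeze_cvgr _ (cvg_cst 0) cv); apply: nearW => n /=.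
rewrite kernel_lt ?leq_addl//.
have X0 : 0 < cesaro_coef (b + 1) (n + m.+1) by exact: c_gt0.
apply/andP; split.
  rewrite mulr_ge0 ?invr_ge0 ?(ltW X0) ?sumr_ge0// => j _.
  by rewrite mulr_ge0 ?c_ge0.
rewrite ler_pdivrMl//.
apply: (@le_trans _ _ (\sum_(j < m.+1) cesaro_coef (b + 1) (n + m.+1) * (b *
  n.+1%:R^-1))); last first.
  by rewrite sumr_const card_ord -[leLHS]mulr_natl mulrCA !mulrA.
apply: ler_sum => j _.
have jm : (j <= m)%N by rewrite -ltnS.
apply: (@le_trans _ _ (cesaro_coef b (n + m.+1 - j))).
  rewrite ler_piMr ?c_ge0//.
  have a01 : 0 <= a <= 1 by rewrite a_ge0 ltW.
  by rewrite -[leRHS](cesaro_coef0 a) (nonincreasing_cesaro_coef a01).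
set i := (n + m.+1 - j)%N.
have ni : (n.+1 <= i)%N by rewrite /i -addnBA ?leqW// subSn// addnS ltnS leq_addr.
apply: (@le_trans _ _ (cesaro_coef (b + 1) i * (b * n.+1%:R^-1))); last first.
  rewrite ler_wpM2r ?mulr_ge0 ?invr_ge0//.
  by apply: nondecreasing_cesaro_coef => //; exact: leq_subr.
rewrite mulrA ler_pdivlMr ?ltr0Sn// [cesaro_coef (b + 1) i * b]mulrC cesaro_coef_shift.
rewrite mulrC ler_wpM2r ?c_ge0// ler_wpDl ?ler_nat// ltW//.
Qed.

End CesaroKernel.

Lemma cvgn_sum (R : realType) (I : Type) (r : seq I) (u : I -> nat -> R) (l : I -> R) :
  (forall i, u i @ \oo --> l i) ->
  (fun n => \sum_(i <- r) u i n) @ \oo --> \sum_(i <- r) l i.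
Proof.
move=> ul; elim: r => [|i r IH].
  by under eq_fun do rewrite big_nil; rewrite big_nil; exact: cvg_cst.
by under eq_fun do rewrite big_cons; rewrite big_cons; apply: cvgD.
Qed.

Section CesaroMean.
Context {R : realType}.

Definition cesaro_mean (b : R) (q : nat -> R) n :=
  (cesaro_coef (b + 1) n)^-1 *
    \sum_(0 <= j < n.+1) cesaro_coef b (n - j)%N * q j.

(** Here [f] stands for the squared norms of the coefficients of a model vector. The indices m >= M
    contribute at most C times a tail of q 0, uniformly in n; each m < M contributes a null sequence
    by [cvg_cesaro_kernel]. *)
Lemma cvg_cesaro_mean_model (a b : R) (f q : nat -> R) :
  0 < a -> a < 1 -> 1 - a < b -> (forall n, 0 <= f n) ->
  (forall j, series (fun n => cesaro_coef a n * f (n + j)%N) @ \oo --> q j) ->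
  cesaro_mean b q @ \oo --> (0 : R).
Proof.
move=> a0 a1 ab f0 fq.
have b0 : 0 < b by rewrite (lt_trans _ ab)// subr_gt0.
have b10 : 0 < b + 1 by rewrite addr_gt0.
have c0 n : 0 <= cesaro_coef a n by rewrite cesaro_coef_ge0// ltW.
have cb0 n : 0 <= cesaro_coef b n by rewrite cesaro_coef_ge0// ltW.
have X0 n : 0 < cesaro_coef (b + 1) n by exact: cesaro_coef_gt0.
have q0 j : 0 <= q j.
  apply: (cvgn_ge (N := 0) (@fq j)) => n _.
  by rewrite /series /= sumr_ge0// => i _; rewrite mulr_ge0.
have [C C0 HC] := cesaro_kernel_le a0 a1 ab.
pose s M := series (fun n => cesaro_coef a n * f n) M.
have sq : s @ \oo --> q 0.
  rewrite (_ : s = series (fun n => cesaro_coef a n * f (n + 0)%N)); first exact: fq.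
  by apply/funext => n; rewrite /s; congr series; apply/funext => m; rewrite addn0.
(* [Q L j] is q j computed from the first [L] values of [f], so that the sums can be exchanged
   before the limit in [L]. *)
pose Q L j := \sum_(m < L | (j <= m)%N) cesaro_coef a (m - j) * f m.
have Qq j : (fun L => Q L j) @ \oo --> q j.
  rewrite -(cvg_shiftn j).
  rewrite (_ : (fun n => _) = series (fun n => cesaro_coef a n * f (n + j)%N));
    first exact: fq.
  apply/funext => n; rewrite /Q /series /= -(big_mkord (fun m => (j <= m)%N) (fun
    m => cesaro_coef a (m - j) * f m)).
  rewrite (big_cat_nat (n := j)) ?leq_addl//= big_nat_cond big1 ?add0r => [|i];
    last first.
    by move=> /andP[/andP[_ ij] ji]; move: (leq_trans ij ji); rewrite ltnn.
  rewrite -{1}[j]add0n big_addn addnK; apply: eq_big => [i|i _];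
    first by rewrite leq_addl.
  by rewrite addnK.
have Qsum n L : \sum_(0 <= j < n.+1) cesaro_coef b (n - j) * Q L j =
    \sum_(0 <= m < L) f m * cesaro_kernel a b m n.
  rewrite !big_mkord.
  under eq_bigr do rewrite /Q mulr_sumr big_mkcond /=.
  rewrite exchange_big /=; apply: eq_bigr => m _.
  rewrite mulr_sumr [RHS]big_mkcond /=; apply: eq_bigr => j _.
  by case: ifP => // _; ring.
have bound n M : \sum_(0 <= j < n.+1) cesaro_coef b (n - j) * q j <=
    \sum_(0 <= m < M) f m * cesaro_kernel a b m n + C * cesaro_coef (b + 1) n *
      (q 0 - s M).
  have cv : (fun L => \sum_(0 <= j < n.+1) cesaro_coef b (n - j) * Q L j) @ \oo -->
      \sum_(0 <= j < n.+1) cesaro_coef b (n - j) * q j.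
    by apply: cvgn_sum => j; exact: cvgn_mull.
  apply: (cvgn_le (N := M) cv) => L ML.
  rewrite Qsum (big_cat_nat (leq0n M) ML)//= lerD2l.
  apply: (@le_trans _ _ (C * cesaro_coef (b + 1) n * (s L - s M))).
    rewrite /s /series /= (big_cat_nat (leq0n M) ML)//= addrAC subrr add0r mulr_sumr.
    apply: ler_sum => m _; rewrite mulrA [leRHS]mulrC ler_wpM2l//.
    by rewrite -mulrA HC.
  rewrite ler_wpM2l ?mulr_ge0 ?(ltW (X0 _))// lerD2r.
  apply: (cvgn_ge (N := L) sq) => N LN.
  rewrite /s /series /= (big_cat_nat (leq0n L) LN)//= lerDl sumr_ge0// => i _.
  by rewrite mulr_ge0.
apply/cvgrPdist_le => e e0.
(* The tail takes half of [e]; the division is by [C + 1] because [C] may be 0. *)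
have [M HM] : exists M, C * (q 0 - s M) <= e / 2.
  have e2 : 0 < e / 2 / (C + 1) by rewrite !divr_gt0// ltr_wpDl.
  have /cvgrPdist_le/(_ _ e2)[M _ HM] := sq; exists M.
  have := HM M (leqnn _) => /= h; have := le_trans (ler_norm _) h => {}h.
  apply: le_trans (ler_wpM2l C0 h) _.
  by rewrite mulrCA ger_pMr ?divr_gt0// ler_pdivrMr ?mul1r ?lerDl// ltr_wpDl.
have cv : (fun n => \sum_(0 <= m < M) f m * ((cesaro_coef (b + 1) n)^-1 *
  cesaro_kernel a b m n))
    @ \oo --> (0 : R).
  rewrite [X in _ --> X](_ : 0 = \sum_(0 <= m < M) f m * 0); last first.
    by rewrite big1// => i _; rewrite mulr0.
  by apply: cvgn_sum => m; apply: cvgn_mull; exact: cvg_cesaro_kernel.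
have e2 : 0 < e / 2 by rewrite divr_gt0.
move/cvgrPdist_le : cv => /(_ _ e2)[N _ HN].
exists N => // n /= /HN /=; rewrite sub0r normrN => h.
rewrite sub0r normrN ger0_norm; last first.
  rewrite mulr_ge0 ?invr_ge0 ?(ltW (X0 _))// sumr_ge0// => j _.
  by rewrite mulr_ge0.
rewrite /cesaro_mean ler_pdivrMl//; apply: le_trans (bound n M) _.
have -> : \sum_(0 <= m < M) f m * cesaro_kernel a b m n =
  cesaro_coef (b + 1) n * \sum_(0 <= m < M) f m * ((cesaro_coef (b + 1) n)^-1 *
    cesaro_kernel a b m n).
  rewrite mulr_sumr; apply: eq_bigr => m _; field.
  by rewrite gt_eqF.
rewrite -mulrA mulrCA -mulrDr ler_wpM2l ?(ltW (X0 _))//.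
have := le_trans (ler_norm _) h; lra.
Qed.

(** If q >= e from N on, the mean at n is at least e k^(b+1)(n-N) / k^(b+1)(n) >= e / (b + 1)^N,
    against the limit 0. *)
Lemma cesaro_mean_small (b : R) (q : nat -> R) : 0 < b ->
  (forall n, 0 <= q n) -> cesaro_mean b q @ \oo --> (0 : R) ->
  forall e, 0 < e -> forall N, exists2 n, (N <= n)%N & q n < e.
Proof.
move=> b0 q0 qm e e0 N; apply: contrapT => H.
have qe n : (N <= n)%N -> e <= q n.
  by move=> Nn; rewrite leNgt; apply/negP => qn; apply: H; exists n.
have b1 : 1 <= b + 1 by rewrite lerDr ltW.
have b10 : 0 < b + 1 by exact: lt_le_trans b1.
have X0 n : 0 < cesaro_coef (b + 1) n by exact: cesaro_coef_gt0.
(* One step multiplies the coefficient by (b + 1 + i) / (i + 1), which is at most b + 1. *)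
have ratio n m : cesaro_coef (b + 1) (n + m) <= (b + 1) ^+ m * cesaro_coef (b + 1) n.
  elim: m => [|m IH]; first by rewrite addn0 mul1r.
  rewrite addnS cesaro_coefS exprSr mulrAC.
  apply: ler_pM IH _ => //; first exact: ltW.
    by rewrite divr_ge0// addr_ge0// ltW.
  rewrite ler_pdivrMr ?ltr0Sn// -natr1 mulrDr mulr1 addrC lerD2r.
  by rewrite ler_peMl.
suff : e / (b + 1) ^+ N <= 0 by rewrite leNgt divr_gt0// exprn_gt0.
apply: (cvgn_ge (N := N) qm) => n Nn.
rewrite /cesaro_mean ler_pdivlMl// (big_cat_nat (n := N)) ?(leq_trans Nn)//=.
apply: (@le_trans _ _ (\sum_(N <= j < n.+1) cesaro_coef b (n - j) * q j)); last first.
  rewrite lerDr sumr_ge0// => j _.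
  by rewrite mulr_ge0 ?cesaro_coef_ge0// ltW.
apply: (@le_trans _ _ (\sum_(N <= j < n.+1) cesaro_coef b (n - j) * e)); last first.
  rewrite big_nat [leRHS]big_nat; apply: ler_sum => j /andP[Nj _].
  by rewrite ler_wpM2l ?cesaro_coef_ge0 ?qe// ltW.
rewrite -mulr_suml.
have -> : \sum_(N <= j < n.+1) cesaro_coef b (n - j) = cesaro_coef (b + 1) (n - N).
  rewrite -cesaro_coef_sum -{1}[N]add0n big_addn subSn// big_mkord.
  rewrite (reindex_inj rev_ord_inj) /=; apply: eq_bigr => i _.
  by rewrite subSS addnC subnDA subKn ?leq_ord.
rewrite mulrCA mulrC ler_wpM2r ?(ltW e0)// ler_pdivrMr ?exprn_gt0//.
by rewrite mulrC -{1}(subnK Nn) ratio.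
Qed.

End CesaroMean.

Lemma limn_einf_eq0P (R : realType) (u : nat -> R) : (forall n, 0 <= u n) ->
  (limn_einf (fun n => (u n)%:E) = 0%E) <->
  (forall e, 0 < e -> forall N, exists2 n, (N <= n)%N & u n < e).
Proof.
move=> u0; split=> [h e e0 N|h].
  apply: contrapT => H.
  have ue n : (N <= n)%N -> e <= u n.
    by move=> Nn; rewrite leNgt; apply/negP => qn; apply: H; exists n.
  suff : (e%:E <= limn_einf (fun n => (u n)%:E))%E by rewrite h lee_fin leNgt e0.
  rewrite limn_einf_lim; apply: lime_ge; first exact: is_cvg_einfs.
  exists N => // n /= Nn; apply: le_ereal_inf_tmp => _ [m /= nm <-].
  by rewrite lee_fin ue// (leq_trans Nn).
rewrite limn_einf_lim (_ : einfs _ = (fun=> 0%E)); first by rewrite lim_cst.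
apply/funext => N; apply/eqP; rewrite eq_le; apply/andP; split; last first.
  by apply: le_ereal_inf_tmp => _ [m /= nm <-]; rewrite lee_fin.
apply/lee_addgt0Pr => e e0; rewrite add0e.
have [n Nn un] := h e e0 N.
apply: (@le_trans _ _ (u n)%:E); last by rewrite lee_fin ltW.
by apply: ereal_inf_lbound; exists n.
Qed.

(** * Hilbert spaces *)

Section HilbertNorm.
Local Open Scope complex_scope.
Context {R : realType} {H : hilbertType R}.
Implicit Types (x y z : H) (c : R[i]).

Lemma hnormE x : `|x| = (hnorm x)%:C.
Proof. by rewrite /hnorm RRe_real// ger0_real. Qed.

Lemma hnorm_ge0 x : 0 <= hnorm x.
Proof. by rewrite -ler0c -hnormE. Qed.

Lemma hnorm_eq0 x : (hnorm x == 0) = (x == 0).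
Proof. by rewrite -[RHS]normr_eq0 hnormE eq_complex /= eqxx andbT. Qed.

Lemma hnorm0 : hnorm (0 : H) = 0.
Proof. by apply/eqP; rewrite hnorm_eq0. Qed.

Lemma hnormN x : hnorm (- x) = hnorm x.
Proof. by rewrite /hnorm normrN. Qed.

Lemma hdistC x y : hnorm (x - y) = hnorm (y - x).
Proof. by rewrite -hnormN opprB. Qed.

Lemma ler_hnormD x y : hnorm (x + y) <= hnorm x + hnorm y.
Proof. by rewrite -lecR rmorphD /= -!hnormE ler_normD. Qed.

Lemma hnormZ c x : hnorm (c *: x) = complex.Re `|c| * hnorm x.
Proof.
apply: complexI; rewrite -hnormE normrZ hnormE rmorphM /= RRe_real//.
Qed.

Lemma hdotBr x y z : hdot x (y - z) = hdot x y - hdot x z.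
Proof. exact: linearBr. Qed.

Lemma hdotPr c x y z : hdot x (c *: y + z) = c^* * hdot x y + hdot x z.
Proof. exact: linearPr. Qed.

(** The underlying real inner product; [Im_hdot] recovers the imaginary part of [hdot] from it. *)
Definition rdot x y : R := complex.Re (hdot x y).

Lemma hdot_conj x y : hdot x y = (hdot y x)^*.
Proof. by rewrite (hermC (hdot : {hermitian H for false & Num.conj})) mul1r. Qed.

Lemma rdotC x y : rdot x y = rdot y x.
Proof. by rewrite /rdot hdot_conj; case: (hdot y x). Qed.

Lemma rdotDl x y z : rdot (x + y) z = rdot x z + rdot y z.
Proof. by rewrite /rdot linearDl raddfD. Qed.

Lemma rdotBl x y z : rdot (x - y) z = rdot x z - rdot y z.
Proof. by rewrite /rdot linearBl raddfB. Qed.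

Lemma rdotDr x y z : rdot x (y + z) = rdot x y + rdot x z.
Proof. by rewrite rdotC rdotDl !(rdotC x). Qed.

Lemma rdotBr x y z : rdot x (y - z) = rdot x y - rdot x z.
Proof. by rewrite rdotC rdotBl !(rdotC x). Qed.

Lemma rdotZl (r : R) x y : rdot (r%:C *: x) y = r * rdot x y.
Proof. by rewrite /rdot linearZl /=; case: (hdot x y) => a b /=;
  rewrite mul0r subr0. Qed.

Lemma rdotZr (r : R) x y : rdot x (r%:C *: y) = r * rdot x y.
Proof. by rewrite rdotC rdotZl rdotC. Qed.

Lemma rdot_suml (c : nat -> R) (u : nat -> H) N y :
  rdot (\sum_(i < N) (c i)%:C *: u i) y = \sum_(i < N) c i * rdot (u i) y.
Proof.
elim: N => [|N IH]; first by rewrite !big_ord0 /rdot linear0l.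
by rewrite !big_ord_recr /= rdotDl IH rdotZl.
Qed.

Lemma Im_hdot x y : complex.Im (hdot x y) = - rdot ('i *: x) y.
Proof. by rewrite /rdot linearZl /= mulrC ReiNIm opprK. Qed.

Lemma rdotxx x : rdot x x = hnorm x ^+ 2.
Proof. by rewrite /rdot hdotE hnormE -rmorphXn. Qed.

Lemma hnormD2 x y : hnorm (x + y) ^+ 2 = hnorm x ^+ 2 + 2 * rdot x y + hnorm y ^+ 2.
Proof. by rewrite -!rdotxx rdotDl !rdotDr (rdotC y x); ring. Qed.

Lemma hnormB2 x y : hnorm (x - y) ^+ 2 = hnorm x ^+ 2 - 2 * rdot x y + hnorm y ^+ 2.
Proof. by rewrite -!rdotxx rdotBl !rdotBr (rdotC y x); ring. Qed.

Lemma hnormD2_le x y : hnorm (x + y) ^+ 2 <= 2 * hnorm x ^+ 2 + 2 * hnorm y ^+ 2.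
Proof.
have := sqr_ge0 (hnorm (x - y)); rewrite hnormB2 hnormD2; lra.
Qed.

Lemma rdot_le x y : rdot x y <= hnorm x * hnorm y.
Proof.
have [->|y0] := eqVneq y 0; first by rewrite /rdot linear0r hnorm0 mulr0.
have [->|x0] := eqVneq x 0; first by rewrite /rdot linear0l hnorm0 mul0r.
have x1 : 0 < hnorm x by rewrite lt_neqAle eq_sym hnorm_eq0 x0 hnorm_ge0.
have y1 : 0 < hnorm y by rewrite lt_neqAle eq_sym hnorm_eq0 y0 hnorm_ge0.
(* Cauchy-Schwarz: the square expands to 2 |x| |y| (|x| |y| - [rdot x y]). *)
have := sqr_ge0 (hnorm ((hnorm y)%:C *: x - (hnorm x)%:C *: y)).
rewrite hnormB2 rdotZl rdotZr !hnormZ !normc_def /= !expr0n !addr0 !sqrtr_sqr.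
rewrite !ger0_norm ?hnorm_ge0// => h.
have : 0 <= (hnorm x * hnorm y) * (hnorm x * hnorm y - rdot x y) by nra.
by rewrite pmulr_rge0 ?mulr_gt0// subr_ge0.
Qed.

Lemma normr_rdot_le x y : `|rdot x y| <= hnorm x * hnorm y.
Proof.
rewrite ler_norml rdot_le andbT lerNl.
have -> : - rdot x y = rdot (- x) y by rewrite /rdot linearNl raddfN.
by rewrite (le_trans (rdot_le _ _))// hnormN.
Qed.

Lemma hilbert_cvgP (u : nat -> H) x :
  u @ \oo --> x <-> (fun n => hnorm (u n - x)) @ \oo --> (0 : R).
Proof.
split=> [/cvgrPdist_lt ux|/cvgrPdist_lt ux].
  apply/cvgrPdist_lt => e e0.
  have [N _ HN] := ux e%:C (etrans (ltcR 0 e) e0).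
  exists N => // n /= /HN /=; rewrite hnormE ltcR hdistC sub0r normrN ger0_norm//.
  exact: hnorm_ge0.
apply/cvgrPdist_lt => e e0.
(* A positive element of [R[i]] is real, so [e] may be replaced by its real part. *)
have eE : e = (complex.Re e)%:C by rewrite RRe_real// gtr0_real.
rewrite eE ltcR in e0 *.
have [N _ HN] := ux _ e0.
exists N => // n /= /HN /=; rewrite hnormE ltcR hdistC sub0r normrN ger0_norm//.
exact: hnorm_ge0.
Qed.

Lemma hilbert_cauchy (u : nat -> H) :
  (forall e : R, 0 < e -> exists N, forall m n, (N <= m)%N -> (N <= n)%N ->
     hnorm (u m - u n) < e) ->
  cvgn u.
Proof.
move=> uC; apply: cauchy_cvg; apply/cauchy_ballP => e e0.
have eE : e = (complex.Re e)%:C by rewrite RRe_real// gtr0_real.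
rewrite eE ltcR in e0 *; have [N HN] := uC _ e0.
exists (u @` [set n | (N <= n)%N], u @` [set n | (N <= n)%N]) => /=.
  by split; exists N => // n /= Nn; exists n.
move=> [_ _] /= [[m Nm <-] [n Nn <-]].
by rewrite -ball_normE /= hnormE ltcR; exact: HN.
Qed.

Lemma cvg_rdotl (u : nat -> H) x y : u @ \oo --> x ->
  (fun n => rdot (u n) y) @ \oo --> rdot x y.
Proof.
move=> /hilbert_cvgP ux; apply/cvgrPdist_le => e e0.
have d0 : 0 < e / (hnorm y + 1) by rewrite divr_gt0// ltr_wpDl// hnorm_ge0.
move/cvgrPdist_le : ux => /(_ _ d0)[N _ HN].
exists N => // n /= /HN /=; rewrite sub0r normrN ger0_norm ?hnorm_ge0// => h.
rewrite -rdotBl (le_trans (normr_rdot_le _ _))// hdistC.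
rewrite (le_trans (ler_wpM2r (hnorm_ge0 _) h))// -mulrA ger_pMr//.
rewrite ler_pdivrMl ?mulr1 ?lerDl// ltr_wpDl// hnorm_ge0//.
Qed.

Lemma cvg_hnorm (u : nat -> H) x : u @ \oo --> x ->
  (fun n => hnorm (u n)) @ \oo --> hnorm x.
Proof.
move=> /hilbert_cvgP ux; apply/cvgrPdist_le => e e0.
move/cvgrPdist_le : ux => /(_ _ e0)[N _ HN].
exists N => // n /= /HN /=; rewrite sub0r normrN ger0_norm ?hnorm_ge0// => h.
apply: le_trans h; rewrite ler_norml.
have := ler_hnormD (u n - x) x; have := ler_hnormD (x - u n) (u n).
rewrite !subrK hdistC => h1 h2; apply/andP; lra.
Qed.

(* The Riesz vector minimises [|x|^2 - 2 Re (f x)]. *)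
Lemma riesz (f : {scalar H}) (M : R) :
  (forall x, complex.Re (f x) <= M * hnorm x) ->
  exists z, forall x, f x = hdot x z.
Proof.
move=> fM; pose g x := complex.Re (f x); pose J x := hnorm x ^+ 2 - 2 * g x.
have gD x y : g (x + y) = g x + g y by rewrite /g linearD raddfD.
have gZ (r : R) x : g (r%:C *: x) = r * g x.
  by rewrite /g linearZ /=; case: (f x) => a b /=; rewrite mul0r subr0.
pose A := [set J x | x in [set: H]].
have Ainf : has_inf A.
  split; first by exists (J 0), 0.
  (* Completing the square: |x|^2 - 2 M |x| >= - M^2. *)
  exists (- M ^+ 2) => _ [x _ <-]; rewrite /J.
  have := fM x; have := sqr_ge0 (hnorm x - M); rewrite -/(g x); nra.
have Jge x : inf A <= J x by apply: inf_lbound; [case: Ainf|exists x].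
have Jn n : {x | J x <= inf A + n.+1%:R^-1}.
  have n0 : 0 < n.+1%:R^-1 :> R by rewrite invr_gt0.
  by apply: cid; have [_ [x _ <-] /ltW h] := inf_adherent n0 Ainf; exists x.
pose u n := sval (Jn n).
have Ju n : J (u n) <= inf A + n.+1%:R^-1 by exact: svalP (Jn n).
have uC : cvgn u.
  apply: hilbert_cauchy => e e0.
  have [N HN] : exists N, forall n, (N <= n)%N -> n.+1%:R^-1 < e ^+ 2 / 4.
    have h0 : 0 < e ^+ 2 / 4 by rewrite divr_gt0// exprn_gt0.
    have /cvgrPdist_lt/(_ _ h0)[N _ HN] := @cvg_harmonic R.
    by exists N => n /HN /=; rewrite sub0r normrN ger0_norm ?invr_ge0.
  exists N => m n /HN hm /HN hn.
  (* Parallelogram law: |u m - u n|^2 / 2 is J(u m) + J(u n) minus twice the value of [J] at the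
     midpoint, which is at least [inf A]. *)
  have := Jge (2^-1%:C *: (u m + u n)).
  have := Ju m; have := Ju n.
  rewrite /J gZ gD hnormZ normc_def /= expr0n addr0 sqrtr_sqr ger0_norm
    ?invr_ge0// exprMn.
  rewrite hnormD2 => h1 h2 h3.
  rewrite -(ltr_pXn2r (_ : 0 < 2)%N) ?nnegrE ?hnorm_ge0// ?(ltW e0)//.
  rewrite hnormB2; move: h1 h2 h3 hm hn; rewrite exprVn.
  move: (n.+1%:R^-1) (m.+1%:R^-1) => ? ?; lra.
have [z uz] : exists z, u @ \oo --> z by apply/cvg_ex.
exists z => x.
have gz y : g y = rdot y z.
  have h (t : R) : 0 <= 2 * t * (rdot y z - g y) + t ^+ 2 * hnorm y ^+ 2.
    have cv : (fun n => 2 * t * (rdot (u n) y - g y) + t ^+ 2 * hnorm y ^+ 2 +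
      n.+1%:R^-1)
       @ \oo --> 2 * t * (rdot z y - g y) + t ^+ 2 * hnorm y ^+ 2 + 0.
      apply: cvgD; last exact: cvg_harmonic.
      apply: cvgD; last exact: cvg_cst.
      apply: cvgM; first exact: cvg_cst.
      by apply: cvgB; [exact: cvg_rdotl|exact: cvg_cst].
    rewrite rdotC -[leRHS]addr0 -(cvg_lim _ cv)//.
    apply: limr_ge; first by apply/cvg_ex; eexists; exact: cv.
    apply: nearW => n.
    have := Jge (u n + t%:C *: y); have := Ju n.
    rewrite /J hnormD2 gD gZ rdotZr hnormZ normc_def /= expr0n addr0 sqrtr_sqr.
    rewrite exprMn real_normK ?num_real// => h1 h2.
    move: h1 h2; move: (n.+1%:R^-1) (inf A) (g (u n)) (g y) (rdot (u n) y).
    by move: (hnorm (u n) ^+ 2) => v1 v2 v3 v4 v5 v6 h1 h2; lra.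
  set c := rdot y z - g y in h; set s := hnorm y ^+ 2 in h.
  have s0 : 0 < s + 1 by rewrite ltr_wpDl// sqr_ge0.
  suff : c ^+ 2 <= 0 by rewrite le_eqVlt ltNge sqr_ge0 orbF sqrf_eq0 subr_eq0 => /eqP.
  (* Close to the minimiser -c / s of 2 t c + t^2 s, but defined also when s = 0. *)
  have := h (- c / (s + 1)).
  have -> : 2 * (- c / (s + 1)) * c + (- c / (s + 1)) ^+ 2 * s = - c ^+ 2 * ((s +
    2) / (s + 1) ^+ 2).
    by field; rewrite gt_eqF.
  by rewrite pmulr_lge0 ?oppr_ge0// divr_gt0 ?exprn_gt0//; lra.
apply/eqP; rewrite eq_complex; apply/andP; split; apply/eqP; first exact: gz.
(* The imaginary parts agree by the real identity at ['i *: x]. *)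
by rewrite Im_hdot -gz /g linearZ /= mulrC ReiNIm opprK.
Qed.

End HilbertNorm.

Section Operators.
Local Open Scope complex_scope.
Context {R : realType} {H K : hilbertType R}.

Lemma hnorm_bounded (T : {linear H -> K}) : continuous T ->
  exists2 M : R, 0 < M & forall x, hnorm (T x) <= M * hnorm x.
Proof.
move=> /linear_bounded_continuous/linear_boundedP/pinfty_ex_gt0[M M0 HM].
have ME : M = (complex.Re M)%:C by rewrite RRe_real// gtr0_real.
rewrite ME ltcR in M0; exists (complex.Re M) => // x.
by have := HM x; rewrite !hnormE {1}ME -(rmorphM (real_complex R)) lecR.
Qed.

Lemma hnorm_bounded_continuous (T : {linear H -> K}) (M : R) :
  (forall x, hnorm (T x) <= M * hnorm x) -> continuous T.
Proof.
move=> HM; apply/linear_bounded_continuous/linear_boundedP.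
exists M%:C; split; first by rewrite complex_real.
move=> r Mr x; rewrite !hnormE (le_trans (_ : _ <= (M * hnorm x)%:C))//.
  by rewrite lecR.
by rewrite rmorphM ler_wpM2r ?lec0r ?ler0c ?hnorm_ge0// ltW.
Qed.

End Operators.

(** Riesz applied to the bounded functional x |-> <T x, y> shows that [xget] in [adjoint] never
    returns its default. *)
Lemma hdot_adjoint (R : realType) (H : hilbertType R) (T : {linear H -> H}) x y :
  continuous T ->
  hdot (T x) y = hdot x (adjoint T y).
Proof.
move=> cT; have [M M0 TM] := hnorm_bounded cT.
rewrite /adjoint; case: xgetP => [z _|]; first exact.
suff [z Hz] : exists z, forall x, hdot (T x) y = hdot x z by move=> /(_ z).
pose f x : R[i] := hdot (T x) y.
have fl : scalar f by move=> c u v; rewrite /f linearP linearPl.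
pose F : {scalar H} := HB.pack f (GRing.isLinear.Build _ _ _ _ f fl).
apply: (@riesz _ _ F (M * hnorm y)) => u /=.
rewrite /f -/(rdot (T u) y) (le_trans (rdot_le _ _))// mulrAC.
by rewrite ler_wpM2r ?hnorm_ge0.
Qed.

(** * Square roots *)

Lemma ler_sum_widen (R : realType) (F : nat -> R) (m n : nat) : (m <= n)%N ->
  (forall i, 0 <= F i) -> \sum_(i < m) F i <= \sum_(i < n) F i.
Proof.
move=> mn F0; rewrite -!(big_mkord xpredT F) (big_cat_nat (leq0n m) mn) /=.
by rewrite lerDl sumr_ge0.
Qed.

(* The index square [i, j < 2K] minus the triangle [i + j < 2K] avoids the
   square [i, j < K]. *)
Lemma cvg_square_triangle (R : realType) (c m : nat -> R) (M : R) :
  (forall n, `|m n| <= M) -> cvgn (series (fun n => `|c n|)) ->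
  (fun K => \sum_(i < K.*2) \sum_(j < K.*2) c i * c j * m (i + j)%N
      - \sum_(i < K.*2) \sum_(j < K.*2 - i) c i * c j * m (i + j)%N)
    @ \oo --> (0 : R).
Proof.
move=> mM sc; pose s N : R := \sum_(i < N) `|c i|.
have M0 : 0 <= M by rewrite (le_trans _ (mM 0%N)).
pose T (g : nat -> nat -> R) K : R :=
  \sum_(i < K.*2) \sum_(j < K.*2 | (K.*2 - i <= j)%N) g i j.
have TE (g : nat -> nat -> R) K : \sum_(i < K.*2) \sum_(j < K.*2) g i j -
    \sum_(i < K.*2) \sum_(j < K.*2 - i) g i j = T g K.
  rewrite -sumrB; apply: eq_bigr => i _.
  rewrite (big_ord_widen K.*2 (fun j => g i j) (leq_subr i K.*2)).
  rewrite (bigID (fun j : 'I_K.*2 => (j < K.*2 - i)%N)) /= addrAC subrr add0r.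
  by apply: eq_bigl => j; rewrite -leqNgt.
have sl : s @ \oo --> limn (series (fun n => `|c n|)).
  rewrite (_ : s = series (fun n => `|c n|)) //.
  by apply/funext => n; rewrite /s /series /= big_mkord.
have s2 : (fun K => s K.*2) @ \oo --> limn (series (fun n => `|c n|)).
  apply: (cvg_comp _ _ _ sl).
  by apply/cvgnyPge => A; exists A => // n /= An;
    rewrite -addnn (leq_trans An)// leq_addr.
(* The two products of partial sums of the absolute series have the same limit. *)
have cv : (fun K => M * (s K.*2 * s K.*2 - s K * s K)) @ \oo --> (0 : R).
  rewrite -[X in _ --> X](mulr0 M); apply: cvgn_mull.
  rewrite -(subrr (limn (series (fun n => `|c n|)) * limn (series (fun n => `|c n|)))).
  by apply: cvgB; apply: cvgM.
under eq_fun do rewrite (TE (fun i j => c i * c j * m (i + j)%N)).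
have cvN : (fun K => - (M * (s K.*2 * s K.*2 - s K * s K))) @ \oo --> (0 : R).
  by rewrite -(oppr0 R); apply: cvgN.
apply: (squeeze_cvgr _ cvN cv); apply: nearW => K.
rewrite -ler_norml.
apply: (@le_trans _ _ (M * T (fun i j => `|c i| * `|c j|) K)).
  rewrite /T mulr_sumr (le_trans (ler_norm_sum _ _ _))//; apply: ler_sum => i _.
  rewrite mulr_sumr (le_trans (ler_norm_sum _ _ _))//; apply: ler_sum => j _.
  by rewrite !normrM mulrC ler_wpM2r// mulr_ge0.
rewrite ler_wpM2l// -TE lerB//.
  rewrite le_eqVlt; apply/orP; left; apply/eqP.
  by rewrite mulr_suml; apply: eq_bigr => i _; rewrite mulr_sumr.
apply: (@le_trans _ _ (\sum_(i < K) \sum_(j < K.*2 - i) `|c i| * `|c j|)).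
  rewrite mulr_suml; apply: ler_sum => i _; rewrite mulr_sumr.
  apply: (@ler_sum_widen _ (fun j => `|c i| * `|c j|)) => [|j];
    last by rewrite mulr_ge0.
  by rewrite -addnn -addnBA ?leq_addr// ltnW.
apply: (@ler_sum_widen _ (fun i => \sum_(j < K.*2 - i) `|c i| * `|c j|)) => [|i].
  by rewrite -addnn leq_addr.
by rewrite sumr_ge0// => j _; rewrite mulr_ge0.
Qed.

Section SquareRoot.
Local Open Scope complex_scope.
Context {R : realType} {H : hilbertType R}.
Variable B : {linear H -> H}.
Hypothesis B_sym : forall x y, rdot (B x) y = rdot x (B y).
Hypothesis B_ge0 : forall x, 0 <= rdot (B x) x.
Hypothesis B_le1 : forall x, rdot (B x) x <= hnorm x ^+ 2.

(* [B - B^2 = (1 - B) B (1 - B) + B (1 - B) B] is a sum of positive operators. *)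
Let B_contr x : hnorm (B x) <= hnorm x.
Proof.
rewrite -(ler_pXn2r (_ : 0 < 2)%N) ?nnegrE ?hnorm_ge0//.
apply: le_trans (B_le1 x).
have := B_ge0 (x - B x); have := B_le1 (B x).
rewrite linearB /= !(rdotBl, rdotBr) -!rdotxx (B_sym (B x) x); lra.
Qed.

Let Bn n x := iter n B x.

Let Bn_linear n : linear (Bn n).
Proof. by move=> c x y; rewrite /Bn; elim: n => //= n ->; rewrite linearP. Qed.

Let Bn_contr n x : hnorm (Bn n x) <= hnorm x.
Proof. by elim: n => //= n; apply: le_trans; exact: B_contr. Qed.

Let rdot_Bn i j x : rdot (Bn i x) (Bn j x) = rdot (Bn (i + j) x) x.
Proof.
elim: j i => [|j IH] i; first by rewrite addn0.
by rewrite addnS -addSn -IH /= B_sym.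
Qed.

Let c n : R := cesaro_coef (- 2^-1) n.

(** All coefficients but the zeroth are negative and the partial sums k^(1/2)(N) are nonnegative, so
    the sum of the absolute values is at most 2. *)
Let c_cvg : cvgn (series (fun n => `|c n|)).
Proof.
apply: nondecreasing_is_cvgn; first exact: nondecreasing_series.
exists 2 => _ [N _ <-]; rewrite /series /= big_mkord.
apply: (@le_trans _ _ (\sum_(i < N.+1) `|c i|)).
  by rewrite big_ord_recr /= lerDl.
have := cesaro_coef_sum (- 2^-1 : R) N.
have : 0 <= cesaro_coef (- 2^-1 + 1 : R) N by apply: cesaro_coef_ge0; lra.
rewrite !big_ord_recl /c /= cesaro_coef0 normr1 => h1 h2.
have -> : \sum_(i < N) `|cesaro_coef (- 2^-1 : R) (bump 0 i)| =
   - \sum_(i < N) cesaro_coef (- 2^-1 : R) (bump 0 i).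
  rewrite -sumrN; apply: eq_bigr => i _; rewrite ltr0_norm//.
  by apply: cesaro_coef_lt0; apply/andP; split; lra.
move: h1 h2; lra.
Qed.

Let S N x : H := \sum_(n < N) (c n)%:C *: Bn n x.

Let S_le M N x : (M <= N)%N ->
  hnorm (S N x - S M x) <=
    (series (fun n => `|c n|) N - series (fun n => `|c n|) M) * hnorm x.
Proof.
move=> MN; rewrite /S /series /= -!(big_mkord xpredT (fun n => (c n)%:C *: Bn n x)).
rewrite (big_cat_nat (leq0n M) MN) /= addrAC subrr add0r.
rewrite (big_cat_nat (leq0n M) MN) /= addrAC subrr add0r mulr_suml.
elim/big_ind2 : _ => [|u1 u2 v1 v2 h1 h2|n _].
- by rewrite hnorm0.
- by rewrite (le_trans (ler_hnormD _ _))// lerD.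
- rewrite hnormZ normc_def /= expr0n addr0 sqrtr_sqr ler_wpM2l//.
Qed.

Let S_cvg x : cvgn (S ^~ x).
Proof.
apply: hilbert_cauchy => e e0.
have h0 : 0 < hnorm x + 1 by rewrite ltr_wpDl// hnorm_ge0.
have d0 : 0 < e / (hnorm x + 1) / 2 by rewrite !divr_gt0.
move/cvgrPdist_lt : c_cvg => /(_ _ d0)[N _ HN].
set s := series _ in HN; set l := limn _ in HN.
have key m n : (N <= m)%N -> (m <= n)%N -> hnorm (S n x - S m x) < e.
  move=> Nm mn; apply: le_lt_trans (S_le x mn) _; rewrite -/s.
  have h : s n - s m <= e / (hnorm x + 1).
    have /= := HN m Nm; have /= := HN n (leq_trans Nm mn).
    rewrite !ltr_norml; move: (s n) (s m) (l) (e / _) => ? ? ? ?; lra.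
  apply: le_lt_trans (ler_wpM2r (hnorm_ge0 _) h) _.
  by rewrite -mulrA gtr_pMr// ltr_pdivrMl// mulr1 ltrDl.
exists N => m n Nm Nn; case/orP: (leq_total m n) => mn; last exact: key.
by rewrite hdistC; exact: key.
Qed.

(* [D = \sum_n k^(-1/2)(n) B^n], the binomial series of [(1 - B)^(1/2)]. *)
Lemma complement_sqrt : exists2 D : {linear H -> H},
  continuous D & forall x, hnorm (D x) ^+ 2 = hnorm x ^+ 2 - rdot (B x) x.
Proof.
pose D x : H := limn (S ^~ x).
have DS x : S ^~ x @ \oo --> D x by exact: S_cvg.
have D_lin : linear D.
  move=> a x y; apply/cvg_lim => //.
  rewrite (_ : (fun N => S N (a *: x + y)) = (fun N => a *: S N x + S N y)).
    by apply: cvgD => //; apply: cvgZr.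
  apply/funext => N; rewrite /S scaler_sumr -big_split /=; apply: eq_bigr => n _.
  by rewrite Bn_linear scalerDr !scalerA mulrC.
pose DL : {linear H -> H} := HB.pack D (GRing.isLinear.Build _ _ _ _ D D_lin).
exists DL => /=.
  apply: (@hnorm_bounded_continuous _ _ _ DL (limn (series (fun n => `|c n|)))) => x /=.
  apply: (cvgn_le (N := 0) (cvg_hnorm (DS x))) => N _.
  have := S_le x (leq0n N); rewrite {2}/S big_ord0 subr0 {2}/series /= big_geq// subr0.
  move/le_trans; apply; rewrite ler_wpM2r ?hnorm_ge0//.
  apply: nondecreasing_cvgn_le => //.
  exact: nondecreasing_series.
move=> x; pose m n := rdot (Bn n x) x.
have mM n : `|m n| <= hnorm x ^+ 2.
  by rewrite (le_trans (normr_rdot_le _ _))// expr2 ler_wpM2r ?hnorm_ge0// Bn_contr.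
have SE N : hnorm (S N x) ^+ 2 = \sum_(i < N) \sum_(j < N) c i * c j * m (i + j)%N.
  rewrite -rdotxx {1}/S rdot_suml; apply: eq_bigr => i _.
  rewrite rdotC /S rdot_suml mulr_sumr; apply: eq_bigr => j _.
  by rewrite rdot_Bn addnC mulrA.
(* The antidiagonal sums are the coefficients of (1 - t)^(1/2) (1 - t)^(1/2) = 1 - t. The index
   [K.+1] makes the triangle large enough to contain its two nonzero terms. *)
have tri K : \sum_(i < K.+1.*2) \sum_(j < K.+1.*2 - i) c i * c j * m (i + j)%N =
    hnorm x ^+ 2 - rdot (B x) x.
  rewrite (big_ord_triangle (fun i j => c i * c j * m (i + j)%N)).
  rewrite (eq_bigr (fun l : 'I_(K.+1.*2) => cesaro_coef (-1) l * m l)) => [|l _];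
    last first.
    rewrite (_ : cesaro_coef (-1) l = cesaro_coef (- 2^-1 - 2^-1) l);
      last by congr cesaro_coef; field.
    rewrite -cesaro_coef_conv mulr_suml; apply: eq_bigr => i _.
    by rewrite subnKC ?leq_ord.
  rewrite doubleS !big_ord_recl /= cesaro_coef0 mul1r big1 => [|i _].
    by rewrite /bump /= cesaro_coefS cesaro_coef0 /m /= rdotxx; field.
  by rewrite /bump /= !add1n cesaro_coefN1 mul0r.
have c1 : (fun K => hnorm (S K.+1.*2 x) ^+ 2) @ \oo --> hnorm (D x) ^+ 2.
  have Sn : (fun N => hnorm (S N x) ^+ 2) @ \oo --> hnorm (D x) ^+ 2.
    by apply: cvgM; exact: cvg_hnorm.
  apply: (cvg_comp _ _ _ Sn).
  by apply/cvgnyPge => A; exists A => // n /= An;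
    rewrite -addnn (leq_trans An)// (leq_trans (leqnSn n))// leq_addr.
have c2 : (fun K => hnorm (S K.+1.*2 x) ^+ 2) @ \oo --> hnorm x ^+ 2 - rdot (B x) x.
  have := cvg_square_triangle mM c_cvg; rewrite -cvg_shiftS => h.
  rewrite -[X in _ --> X]addr0.
  rewrite (_ : (fun K => _) = (fun K => (hnorm x ^+ 2 - rdot (B x) x) +
   (\sum_(i < K.+1.*2) \sum_(j < K.+1.*2) c i * c j * m (i + j)%N
      - \sum_(i < K.+1.*2) \sum_(j < K.+1.*2 - i) c i * c j * m (i + j)%N))).
    by apply: cvgD => //; exact: cvg_cst.
  by apply/funext => K; rewrite tri SE addrC subrK.
exact: (cvg_unique _ c1 c2).
Qed.

End SquareRoot.

(** * Closed subspaces as Hilbert spaces *)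

Section Subspace.
Local Open Scope complex_scope.
Context {R : realType} {H : hilbertType R}.
Variables (A : set H) (hA : closed_subspace A).

(** The closedness proof is an argument so that the submodule instance can be attached to the
    predicate. *)
Definition subspace_pred of closed_subspace A : pred H := fun x => `[< A x >].

Lemma subspace_pred_closed : GRing.submod_closed (subspace_pred hA).
Proof.
have [_ A0 AZ] := hA; split; first exact/asboolP.
by move=> c x y /asboolP Ax /asboolP Ay; apply/asboolP/AZ.
Qed.

HB.instance Definition _ := GRing.isSubmodClosed.Build R[i] H (subspace_pred hA)
  subspace_pred_closed.

Record hilbert_sub := HilbertSub {
  hilbert_sub_val :> H ;
  hilbert_sub_subproof : hilbert_sub_val \in subspace_pred hA }.

HB.instance Definition _ := [isSub for hilbert_sub_val].
HB.instance Definition _ := [Choice of hilbert_sub by <:].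
HB.instance Definition _ := [SubChoice_isSubLmodule of hilbert_sub by <:].

Let norm (x : hilbert_sub) : R[i] := `|hilbert_sub_val x|.

Let norm_leD x y : norm (x + y) <= norm x + norm y.
Proof. exact: ler_normD. Qed.

Let normZ (c : R[i]) x : norm (c *: x) = `|c| * norm x.
Proof. exact: normrZ. Qed.

Let norm_eq0 x : norm x = 0 -> x = 0.
Proof. by move=> /normr0_eq0 x0; apply: val_inj. Qed.

HB.instance Definition _ := Lmodule_isNormed.Build R[i] hilbert_sub
  norm_leD normZ norm_eq0.

(** The image filter converges in [H], and closedness keeps its limit in [A]. *)
Lemma hilbert_sub_complete (F : set_system hilbert_sub) :
  ProperFilter F -> cauchy F -> cvg F.
Proof.
move=> FF Fc.
have /cauchy_cvg/cvg_ex[/= x Fx] : cauchy (hilbert_sub_val @ F).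
  apply/cauchy_ballP => e e0.
  move/cauchy_ballP : Fc => /(_ _ e0)[[P Q] /= [FP FQ] PQ].
  exists (hilbert_sub_val @` P, hilbert_sub_val @` Q) => /=.
    split; [apply: filterS FP|apply: filterS FQ] => z Pz; first by exists z.
    by exists z.
  move=> [_ _] /= [[y Py <-] [z Qz <-]].
  by have := PQ (y, z) (conj Py Qz); rewrite -!ball_normE.
have Ax : A x.
  have [clA _ _] := hA; apply: clA => B nB.
  have /filter_ex[z Bz] : F (hilbert_sub_val @^-1` B) := Fx _ nB.
  exists (hilbert_sub_val z); split=> //.
  exact/asboolP/(hilbert_sub_subproof z).
apply/cvg_ex; exists (HilbertSub (asboolT Ax : x \in subspace_pred hA)).
apply/cvg_ballP => e e0; move/cvg_ballP : Fx => /(_ _ e0).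
by apply: filterS => z; rewrite -!ball_normE.
Qed.

HB.instance Definition _ := Uniform_isComplete.Build hilbert_sub hilbert_sub_complete.

Definition sub_hdot (x y : hilbert_sub) : R[i] :=
  hdot (hilbert_sub_val x) (hilbert_sub_val y).

Let sub_hdot_zmodl y : zmod_morphism (sub_hdot ^~ y).
Proof. by move=> u v; rewrite /sub_hdot linearBl. Qed.

Let sub_hdot_zmodr y : zmod_morphism (sub_hdot y).
Proof. by move=> u v; rewrite /sub_hdot linearBr. Qed.

Let sub_hdot_scalel y : scalable_for *%R (sub_hdot ^~ y).
Proof. by move=> c u; rewrite /sub_hdot linearZl_LR. Qed.

Let sub_hdot_scaler y : scalable_for (Num.conj \; *%R) (sub_hdot y).
Proof. by move=> c u; rewrite /sub_hdot linearZr_LR. Qed.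

HB.instance Definition _ := isBilinear.Build R[i] hilbert_sub hilbert_sub R[i]
  *%R (Num.conj \; *%R) sub_hdot
  sub_hdot_zmodl sub_hdot_zmodr sub_hdot_scalel sub_hdot_scaler.

Let sub_hdot_herm x y : sub_hdot x y = (-1) ^+ false * Num.conj (sub_hdot y x).
Proof. by rewrite mul1r /sub_hdot hdot_conj. Qed.

HB.instance Definition _ := isHermitianSesquilinear.Build R[i] hilbert_sub
  false Num.conj sub_hdot sub_hdot_herm.

Let sub_hdot_gt0 x : x != 0 -> 0 < sub_hdot x x.
Proof. by move=> x0; rewrite /sub_hdot neq0_dnorm_gt0. Qed.

HB.instance Definition _ := isDotProduct.Build R[i] hilbert_sub sub_hdot sub_hdot_gt0.

Let sub_hdotE x : sub_hdot x x = `|x| ^+ 2.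
Proof. by rewrite /sub_hdot hdotE. Qed.

HB.instance Definition _ := CompleteNormedModule_isHilbert.Build R hilbert_sub
  sub_hdotE.

End Subspace.

(** * The defect operator and the model *)

Lemma iter_linear (K : pzRingType) (V : lmodType K) (T : {linear V -> V}) n :
  linear (iter n T).
Proof. by move=> c x y; elim: n => //= n ->; rewrite linearP. Qed.

Section AContraction.
Local Open Scope complex_scope.
Context {R : realType} {H : hilbertType R}.
Variables (a : R) (T : {linear H -> H}).
Hypotheses (T_bounded : continuous T) (a_gt0 : 0 < a) (a_lt1 : a < 1).
Hypothesis T_contr : a_contraction a T.

Lemma hdot_inj (u v : H) : (forall x, hdot x u = hdot x v) -> u = v.
Proof.
move=> uv; apply/eqP; rewrite -subr_eq0 -normr_eq0 -sqrf_eq0 -hdotE.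
by rewrite hdotBr uv subrr.
Qed.

Lemma adjoint_linear : linear (adjoint T).
Proof.
move=> c y z; apply: hdot_inj => x.
by rewrite hdotPr -!hdot_adjoint// hdotPr.
Qed.

Lemma hdot_iter_adjoint n x y : hdot x (iter n (adjoint T) y) = hdot (iter n T x) y.
Proof. by elim: n x => //= n IH x; rewrite -hdot_adjoint// IH -iterSr. Qed.

Let c n : R := cesaro_coef (- a) n.

Let opp_a : -1 < - a < 0.
Proof. by rewrite ltrN2 a_lt1 oppr_lt0. Qed.

Let gram n x := iter n (adjoint T) (iter n T x).

Let gram_linear n : linear (gram n).
Proof.
pose Tadj : {linear H -> H} := HB.pack (adjoint T) (GRing.isLinear.Build _ _ _ _
  _ adjoint_linear).
move=> k x y; rewrite /gram iter_linear.
exact: (iter_linear Tadj).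
Qed.

(** Since alpha_0 = 1 is the only positive coefficient, the partial sums are 2 x minus those of the
    absolute series. *)
Let alpha_op_cvg x : series (fun n => alpha_term a T n x) @ \oo --> alpha_op a T x.
Proof.
have [/(_ x) /cvg_ex[/= l hl] _] := T_contr.
suff /cvgP : series (fun n => alpha_term a T n x) @ \oo --> x + x - l by [].
rewrite -cvg_shiftS.
rewrite (_ : (fun n => _) = (fun n => x + x - series (fun n => alpha_abs_term a T
  n x) n.+1)).
  by apply: cvgB; [exact: cvg_cst|rewrite cvg_shiftS].
apply/funext => N; rewrite /series /= !big_nat_recl//= opprD addrA.
rewrite /alpha_term /alpha_abs_term cesaro_numberE /= cesaro_coef0 normr1 scale1r addrK.
congr (_ + _); rewrite -sumrN; apply: eq_bigr => i _.
by rewrite ltr0_norm ?cesaro_coef_lt0// rmorphN scaleNr opprK.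
Qed.

Let alpha_opE x : (fun N => \sum_(n < N) (c n)%:C *: gram n x) @ \oo --> alpha_op a T x.
Proof.
rewrite (_ : (fun N => _) = series (fun n => alpha_term a T n x)) //.
apply/funext => N; rewrite /series /= big_mkord; apply: eq_bigr => n _.
by rewrite /alpha_term cesaro_numberE.
Qed.

Let alpha_op_linear : linear (alpha_op a T).
Proof.
move=> k x y.
have E N : \sum_(n < N) (c n)%:C *: gram n (k *: x + y) =
    k *: (\sum_(n < N) (c n)%:C *: gram n x) + \sum_(n < N) (c n)%:C *: gram n y.
  rewrite scaler_sumr -big_split /=; apply: eq_bigr => n _.
  by rewrite gram_linear scalerDr !scalerA mulrC.
have h1 := @alpha_opE (k *: x + y).
have h2 : (fun N => k *: (\sum_(n < N) (c n)%:C *: gram n x) + \sum_(n < N) (c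
  n)%:C *: gram n y)
    @ \oo --> k *: alpha_op a T x + alpha_op a T y.
  by apply: cvgD; [apply: cvgZr|]; exact: alpha_opE.
rewrite (funext E) in h1.
exact: (cvg_unique _ h1 h2).
Qed.

Let cvg_rdot_alpha_op x y :
  (fun N => \sum_(n < N) c n * rdot (iter n T x) (iter n T y)) @ \oo --> rdot
    (alpha_op a T x) y.
Proof.
rewrite (_ : (fun N => _) = (fun N => rdot (\sum_(n < N) (c n)%:C *: gram n x) y)).
  exact: cvg_rdotl.
apply/funext => N; rewrite (rdot_suml c (fun n => gram n x)); apply: eq_bigr => n _.
by rewrite [in RHS]rdotC [in RHS]/rdot hdot_iter_adjoint -/(rdot _ _) rdotC.
Qed.

(** [D] is the square root of A = alpha(T^*, T), obtained from [complement_sqrt] with B = 1 - A: B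
    >= 0 because alpha_n < 0 for n > 0, and B <= 1 because A >= 0. *)
Lemma defect_operator : exists2 D : {linear H -> H}, continuous D &
  forall x, series (fun n => cesaro_coef (- a) n * hnorm (iter n T x) ^+ 2) @ \oo -->
    hnorm (D x) ^+ 2.
Proof.
pose B x := x - alpha_op a T x.
have B_lin : linear B.
  by move=> k x y; rewrite /B alpha_op_linear scalerBr opprD addrACA.
pose BL : {linear H -> H} := HB.pack B (GRing.isLinear.Build _ _ _ _ B B_lin).
have A_sym x y : rdot (alpha_op a T x) y = rdot x (alpha_op a T y).
  rewrite [RHS]rdotC; have h := @cvg_rdot_alpha_op y x.
  have E N : \sum_(n < N) c n * rdot (iter n T y) (iter n T x) = \sum_(n < N) c n
    * rdot (iter n T x) (iter n T y).
    by apply: eq_bigr => n _; rewrite rdotC.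
  rewrite (funext E) in h.
  exact: (cvg_unique _ (@cvg_rdot_alpha_op x y) h).
have [|x|x|D cD DE] := @complement_sqrt _ _ BL.
- by move=> x y; rewrite /= /B rdotBl rdotBr A_sym.
- rewrite /= /B rdotBl subr_ge0.
  apply: (cvgn_le (N := 1) (@cvg_rdot_alpha_op x x)) => -[//|N] _.
  rewrite big_ord_recl /= /c cesaro_coef0 mul1r gerDl sumr_le0// => n _.
  by rewrite rdotxx mulr_le0_ge0 ?sqr_ge0// ltW// cesaro_coef_lt0.
- rewrite /= /B rdotBl rdotxx gerBl.
  by have [_ /(_ x)] := T_contr; rewrite lecE => /andP[_].
exists D => // x; rewrite DE /= /B rdotBl rdotxx opprB addrC subrK.
rewrite (_ : series _ = (fun N => \sum_(n < N) c n * rdot (iter n T x) (iter n T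
  x))) //.
by apply/funext => N; rewrite /series /= big_mkord; apply: eq_bigr => n _;
  rewrite rdotxx.
Qed.

End AContraction.

(** * The extended squared norm of the model space *)

Section ModelNorm.
Context {R : realType} {E W : hilbertType R} (k : R^nat).
Hypothesis k_ge0 : forall n, 0 <= k n.
Implicit Types (u v : (nat -> E) * W).

Lemma hk_norm2_ge0 (f : nat -> E) : (0 <= hk_norm2 k f)%E.
Proof.
apply: nneseries_ge0 => n _ _; rewrite lee_fin mulr_ge0// sqr_ge0//.
Qed.

Lemma model_norm2_ge0 u : (0 <= model_norm2 k u)%E.
Proof. by rewrite adde_ge0 ?hk_norm2_ge0// lee_fin sqr_ge0. Qed.

(** Coefficientwise [hnormD2_le]; it serves as a triangle inequality for squared norms that may be
    infinite. *)
Lemma model_norm2D_le u v :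
  (model_norm2 k (u + v)%R <= 2%:E * model_norm2 k u + 2%:E * model_norm2 k v)%E.
Proof.
have h0 (f : nat -> E) n : (0 <= (k n * hnorm (f n) ^+ 2)%:E)%E by rewrite
  lee_fin mulr_ge0// sqr_ge0.
rewrite /model_norm2 !ge0_muleDr ?hk_norm2_ge0 ?lee_fin ?sqr_ge0//.
rewrite addeACA leeD//; last by rewrite -!EFinM -EFinD lee_fin hnormD2_le.
rewrite /hk_norm2 -!nneseriesZl// -nneseriesD//=; last 2 first.
- by move=> n _ _; rewrite mule_ge0.
- by move=> n _ _; rewrite mule_ge0.
apply: lee_nneseries => n _ //; rewrite -!EFinM -EFinD lee_fin.
rewrite !(mulrCA 2%R (k n)) -mulrDr ler_wpM2l//.
exact: hnormD2_le.
Qed.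

Lemma model_norm2N u : model_norm2 k (- u) = model_norm2 k u.
Proof.
rewrite /model_norm2 /= hnormN; congr (_ + _)%E.
by apply: eq_eseriesr => n _ /=; rewrite hnormN.
Qed.

Lemma model_norm2_eq0 u : (forall n, 0 < k n) -> model_norm2 k u = 0%E -> u = 0.
Proof.
move=> k_gt0 /eqP; rewrite padde_eq0 ?hk_norm2_ge0 ?lee_fin ?sqr_ge0// =>
  /andP[/eqP hk].
rewrite eqe sqrf_eq0 hnorm_eq0 => /eqP u2.
rewrite [u]surjective_pairing u2; congr pair; apply/funext => n; apply/eqP.
rewrite -hnorm_eq0 -sqrf_eq0 -(mulrI_eq0 _ (lregP (lt0r_neq0 (k_gt0 n)))).
rewrite -eqe eq_le; apply/andP; split; last by rewrite lee_fin mulr_ge0// sqr_ge0.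
rewrite (_ : 0%:E = hk_norm2 k u.1); last by rewrite hk.
rewrite /hk_norm2 (@nneseriesD1 _ _ n)//; last by move=> i _;
  rewrite lee_fin mulr_ge0// sqr_ge0.
by rewrite leeDl// nneseries_ge0// => i _ _; rewrite lee_fin mulr_ge0// sqr_ge0.
Qed.

End ModelNorm.

(** * Neighbourhoods and closures in terms of the real norm *)

Section HilbertTopology.
Local Open Scope complex_scope.
Context {R : realType} {H : hilbertType R}.
Implicit Types (A B : set H) (x : H).

Lemma hilbert_nbhsP x B :
  nbhs x B <-> exists2 e : R, 0 < e & forall z, hnorm (x - z) < e -> B z.
Proof.
split=> [/nbhs_normP[e e0 eB]|[e e0 eB]].
  have eE : e = (complex.Re e)%:C by rewrite RRe_real// gtr0_real.
  exists (complex.Re e); first by rewrite -ltcR -eE.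
  by move=> z xz; apply: eB => /=; rewrite hnormE eE ltcR.
apply/nbhs_normP; exists e%:C; first by rewrite /= ltcR.
by move=> z /=; rewrite hnormE ltcR; exact: eB.
Qed.

Lemma hilbert_closureP A x :
  closure A x <-> forall e : R, 0 < e -> exists2 z, A z & hnorm (x - z) < e.
Proof.
split=> [clA e e0|clA B /hilbert_nbhsP[e e0 eB]].
  have [|z [Az xz]] := clA [set z | hnorm (x - z) < e]; last by exists z.
  by apply/hilbert_nbhsP; exists e.
by have [z Az xz] := clA e e0; exists z; split=> //; exact: eB.
Qed.

Lemma closed_subspace_closure A : A 0 ->
  (forall (c : R[i]) x y, A x -> A y -> A (c *: x + y)) ->
  closed_subspace (closure A).
Proof.
move=> A0 AZ; split; [exact: closed_closure|exact: subset_closure|].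
move=> c x y /hilbert_closureP clx /hilbert_closureP cly.
apply/hilbert_closureP => e e0; pose r := complex.Re `|c|.
have r0 : 0 <= r by rewrite -ler0c RRe_real ?normr_ge0// ger0_real.
have d0 : 0 < e / (2 * (r + 1)) by rewrite divr_gt0// mulr_gt0// ltr_wpDl.
have e2 : 0 < e / 2 by rewrite divr_gt0.
have [u Au xu] := clx _ d0; have [v Av yv] := cly _ e2.
exists (c *: u + v); first exact: AZ.
rewrite opprD addrACA -scalerBr; apply: le_lt_trans (ler_hnormD _ _) _.
rewrite hnormZ -/r.
have : r * hnorm (x - u) <= e / 2.
  apply: le_trans (ler_wpM2l r0 (ltW xu)) _.
  have -> : r * (e / (2 * (r + 1))) = e / 2 * (r / (r + 1)).
    by field; rewrite gt_eqF// ltr_wpDl.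
  by rewrite ger_pMr// ler_pdivrMr ?mul1r ?lerDl// ltr_wpDl.
by move: yv; lra.
Qed.

Lemma closed_subspace0 : closed_subspace [set (0 : H)].
Proof.
split=> //.
  move=> x /hilbert_closureP clx; apply/eqP; rewrite -hnorm_eq0 eq_le hnorm_ge0 andbT.
  apply/ler_addgt0Pr => e /clx[z -> /ltW]; rewrite subr0 add0r//.
by move=> c x y -> ->; rewrite scaler0 addr0.
Qed.

End HilbertTopology.

(** * The model without isometric part *)

Section PureShiftModel.
Local Open Scope complex_scope.
Context {R : realType} {H : hilbertType R}.
Hypothesis H_separable : separable_space H.
Variables (a : R) (T D : {linear H -> H}).
Hypotheses (a_gt0 : 0 < a) (D_bounded : continuous D).
Hypothesis norm_eq : forall x,
  series (fun n => cesaro_coef a n * hnorm (D (iter n T x)) ^+ 2) @ \oo --> hnorm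
    x ^+ 2.

Let k_gt0 n : 0 < cesaro_number a n.
Proof. by rewrite cesaro_numberE cesaro_coef_gt0. Qed.

Let k_ge0 n : 0 <= cesaro_number a n.
Proof. exact: ltW. Qed.

Lemma closed_range_subspace : closed_subspace (closure (range D)).
Proof.
apply: closed_subspace_closure; first by exists 0 => //; rewrite linear0.
by move=> c _ _ [x _ <-] [y _ <-]; exists (c *: x + y) => //; rewrite linearP.
Qed.

Let E : hilbertType R := hilbert_sub closed_range_subspace.
Let W : hilbertType R := hilbert_sub (@closed_subspace0 R H).

Let W0 (w : W) : w = 0.
Proof.
apply: val_inj; case: w => w ww /=; move/asboolP : (ww) => /= w0.
by rewrite w0.
Qed.

Let De_sub x : D x \in subspace_pred closed_range_subspace.
Proof. by apply/asboolP/subset_closure; exists x. Qed.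

Let De x : E := HilbertSub (De_sub x).

Let De_lin : linear De.
Proof. by move=> c x y; apply: val_inj; rewrite /= linearP. Qed.

Let hnorm_De x : hnorm (De x) = hnorm (D x).
Proof. by []. Qed.

Let De_dense (y : E) (e : R) : 0 < e -> exists x, hnorm (y - De x) < e.
Proof.
move=> e0; have /asboolP/hilbert_closureP/(_ _ e0)[_ [x _ <-] h] :=
  hilbert_sub_subproof y.
by exists x.
Qed.

(** The image of a countable dense set under a bounded map with dense range is dense. *)
Let E_separable : separable_space E.
Proof.
have [S cS dS] := H_separable.
exists (De @` S); first exact: card_le_trans (card_image_le _ _) cS.
have [M M0 DM] := hnorm_bounded D_bounded.
move=> O [y Oy] Oo.
have /hilbert_nbhsP[e e0 eO] : nbhs y O by apply: open_nbhs_nbhs.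
have e2 : 0 < e / 2 by rewrite divr_gt0.
have [x yx] := De_dense y e2.
have d0 : 0 < e / 2 / M by rewrite !divr_gt0.
pose B := [set z : H | hnorm (x - z) < e / 2 / M].
have [z [Bz Sz]] : B `&` S !=set0.
  have nB : nbhs x B by apply/hilbert_nbhsP; exists (e / 2 / M).
  have [|z [Bz Sz]] := dS B^° _ (open_interior _); first by exists x.
  by exists z; split=> //; exact: interior_subset.
exists (De z); split; last by exists z.
apply: eO; rewrite -(subrK (De x) y) -addrA.
apply: le_lt_trans (ler_hnormD _ _) _.
have -> : De x - De z = De (x - z).
  by apply: val_inj; rewrite /= linearB.
have : hnorm (De (x - z)) < e / 2.
  rewrite hnorm_De; apply: le_lt_trans (DM _) _.
  by rewrite mulrC -ltr_pdivlMr.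
by move: yx; lra.
Qed.

Let W_separable : separable_space W.
Proof.
exists [set 0]; first exact: countable1.
by move=> O [w Ow] _; exists 0; split=> //; rewrite -(W0 w).
Qed.

Let U x : (nat -> E) * W := (fun n => De (iter n T x), 0).

Let U_lin : linear U.
Proof.
move=> c x y; apply: injective_projections => /=; last by rewrite [RHS]W0.
by apply/funext => n; rewrite iter_linear De_lin.
Qed.

Let UL : {linear H -> ((nat -> E) * W)%type} := HB.pack U (GRing.isLinear.Build _
  _ _ _ U U_lin).

Let U_norm x : model_norm2 (cesaro_number a) (UL x) = (hnorm x ^+ 2)%:E.
Proof.
rewrite /model_norm2 /= hnorm0 expr0n adde0 /hk_norm2 cesaro_numberE.
apply/cvg_lim => //.
rewrite (_ : (fun n => _) = EFin \o series (fun n => cesaro_coef a n * hnorm (D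
  (iter n T x)) ^+ 2)).
  exact: (cvg_comp _ _ (@norm_eq x)).
by apply/funext => n; rewrite /series /= sumEFin.
Qed.

(** [UL] is isometric and [H] is complete: a convergent sequence in the range pulls back to a Cauchy
    sequence, whose limit is mapped to the given limit. *)
Let U_closed : model_closed_subspace (cesaro_number a) (range UL).
Proof.
have N2 := model_norm2D_le (E := E) (W := W) k_ge0.
split.
- by move=> _ [x _ <-]; rewrite /model_space /= U_norm ltry.
- by exists 0 => //; rewrite linear0.
- by move=> c _ _ [x _ <-] [y _ <-]; exists (c *: x + y) => //; rewrite linearP.
move=> u_ u Lu _ cu.
have [x_ xE] : exists x_ : nat -> H, forall n, UL (x_ n) = u_ n.
  have h n : {x | UL x = u_ n} by apply: cid; have [x _ <-] := Lu n; exists x.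
  by exists (fun n => sval (h n)) => n; exact: svalP (h n).
have small e : 0 < e -> exists N, forall n, (N <= n)%N ->
    (model_norm2 (cesaro_number a) (u_ n - u)%R < e%:E)%E.
  move=> e0; have [|N _ HN] := cu [set x | (x < e%:E)%E]; last by exists N.
  have : nbhs (0 : R) [set r | r < e] by exact: lt_nbhsl.
  by apply: filterS => r /=; rewrite lte_fin.
have /cvg_ex[/= x xx] : cvgn x_.
  apply: hilbert_cauchy => e e0.
  have e4 : 0 < e ^+ 2 / 4 by rewrite divr_gt0// exprn_gt0.
  have [N HN] := small _ e4; exists N => m n /HN hm /HN hn.
  rewrite -(ltr_pXn2r (_ : 0 < 2)%N) ?nnegrE ?hnorm_ge0 ?(ltW e0)//.
  rewrite -lte_fin -U_norm linearB !xE.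
  rewrite (_ : u_ m - u_ n = (u_ m - u) + - (u_ n - u));
    last by rewrite opprB addrA subrK.
  apply: le_lt_trans (N2 _ _) _; rewrite model_norm2N.
  have -> : (e ^+ 2)%:E = (2%:E * (e ^+ 2 / 4)%:E + 2%:E * (e ^+ 2 / 4)%:E)%E.
    by rewrite -!EFinM -EFinD; congr EFin; field.
  by rewrite lteD// lte_pmul2l.
exists x => //; apply/eqP; rewrite -subr_eq0; apply/eqP.
apply: (model_norm2_eq0 k_ge0 k_gt0); apply/eqP; rewrite eq_le model_norm2_ge0// andbT.
apply/lee_addgt0Pr => e e0; rewrite add0e.
have e4 : 0 < e / 4 by rewrite divr_gt0.
have [N HN] := small _ e4.
have [n Nn xn] : exists2 n, (N <= n)%N & hnorm (x - x_ n) ^+ 2 < e / 4.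
  (* A distance below 1 has a square no larger than itself. *)
  have d0 : 0 < Order.min 1 (e / 4) by rewrite lt_min ltr01 /=.
  move/hilbert_cvgP/cvgrPdist_lt : xx => /(_ _ d0)[N' _ HN'].
  exists (maxn N N'); first exact: leq_maxl.
  have := HN' (maxn N N') (leq_maxr _ _);
    rewrite /= sub0r normrN ger0_norm ?hnorm_ge0//.
  rewrite lt_min hdistC => /andP[h1 h2]; apply: le_lt_trans h2.
  by rewrite expr2 ler_piMl ?hnorm_ge0// ltW.
rewrite (_ : UL x - u = UL (x - x_ n) + (u_ n - u));
  last by rewrite linearB xE addrA subrK.
apply: le_trans (N2 _ _) _; rewrite U_norm.
have -> : e%:E = (2%:E * (e / 4)%:E + 2%:E * (e / 4)%:E)%E.
  by rewrite -!EFinM -EFinD; congr EFin; field.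
by rewrite leeD// lee_pmul2l// ?lee_fin ltW// HN.
Qed.

Let S : {linear W -> W} := idfun.

(** Kept transparent, so that the minimality proof can see [E], [W] and [UL]. *)
Let M : model a T.
Proof.
refine (@Model R H a T E W S (range UL) UL E_separable W_separable _ U_closed _
  erefl U_norm _) => //.
- move=> _ [x _ <-]; exists (T x) => //.
  rewrite /model_operator /= /U /backward_shift; congr pair.
  by apply/funext => n; rewrite -iterSr.
- move=> x; rewrite /model_operator /= /U /backward_shift; congr pair.
  by apply/funext => n; rewrite -iterSr.
Defined.

(** The zeroth coefficients D x of the range are dense in [E], so no proper closed subspace holds
    them; [W] is zero and has no proper subspace. *)
Lemma pure_shift_minimal_model : exists M : model a T, minimal_model M.
Proof.
exists M; split.
  move=> E' [E'cl _ _] E'T L; apply: E'T; apply/seteqP; split=> // y _.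
  apply: E'cl; apply/hilbert_closureP => e e0.
  have [x yx] := De_dense y e0; exists (De x) => //.
  by have := L (UL x) (ex_intro2 _ _ x I erefl) 0%N.
move=> W' [_ W'0 _] _ W'T _; apply: W'T; apply/seteqP; split=> // w _.
by rewrite (W0 w).
Qed.

End PureShiftModel.

(** * Orbits of [T] seen in an arbitrary model *)

Section ModelCoefficients.
Context {R : realType} {H : hilbertType R}.
Variables (a : R) (T : {linear H -> H}) (M : model a T).

Lemma model_unitary_iter j x :
  model_unitary M (iter j T x) =
  (fun n => (model_unitary M x).1 (n + j)%N, iter j (model_S M) (model_unitary M x).2).
Proof.
elim: j => [|j IH] /=.
  rewrite [LHS]surjective_pairing; congr pair.
  by apply/funext => n; rewrite addn0.
rewrite model_unitary_intertwines IH /model_operator /backward_shift /=.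
by congr pair; apply/funext => n; rewrite addSnnS.
Qed.

Hypothesis a_gt0 : 0 < a.

Let k_ge0 n : 0 <= cesaro_number a n.
Proof. by rewrite cesaro_numberE cesaro_coef_ge0// ltW. Qed.

Lemma hnorm_model_W_le x j : hnorm (model_unitary M x).2 <= hnorm (iter j T x).
Proof.
have -> : hnorm (model_unitary M x).2 = hnorm (model_unitary M (iter j T x)).2.
  by rewrite model_unitary_iter /=; elim: j => //= j ->; rewrite model_S_isometry.
rewrite -(ler_pXn2r (_ : 0 < 2)%N) ?nnegrE ?hnorm_ge0//.
rewrite -lee_fin -(model_unitary_norm M) leeDr// hk_norm2_ge0//.
Qed.

(** With no isometric part, T^j only shifts the coefficients, so the norm identity for T^j x becomes
    a real series in the shifted coefficients of x. *)
Lemma cvg_model_coef x j : (model_unitary M x).2 = 0 ->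
  series (fun n => cesaro_coef a n * hnorm ((model_unitary M x).1 (n + j)%N) ^+ 2)
    @ \oo --> hnorm (iter j T x) ^+ 2.
Proof.
move=> x2; have := model_unitary_norm M (iter j T x).
rewrite model_unitary_iter /model_norm2 /= x2.
have -> : iter j (model_S M) 0 = 0 by elim: j => //= j ->; rewrite linear0.
rewrite hnorm0 expr0n adde0 => hk.
have : (fun N => \sum_(0 <= n < N) (cesaro_number a n *
    hnorm ((model_unitary M x).1 (n + j)%N) ^+ 2)%:E)%E @ \oo --> (hnorm (iter j
      T x) ^+ 2)%:E.
  rewrite -hk; apply: is_cvg_nneseries => n _ _.
  by rewrite lee_fin mulr_ge0// sqr_ge0.
rewrite cesaro_numberE => /fine_cvg; rewrite (_ : fine \o _ =
  series (fun n => cesaro_coef a n * hnorm ((model_unitary M x).1 (n + j)%N) ^+ 2)) //.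
by apply/funext => N; rewrite /= sumEFin.
Qed.

End ModelCoefficients.

(** * The cycle of implications from (i) to (ii), (iii) and back *)

Theorem theorem1p15 (R : realType) (H : hilbertType R)
  (H_separable : separable_space H)
  (T : {linear H -> H}) (T_bounded : continuous T)
  (a b : R) (a_gt0 : 0 < a) (a_lt1 : a < 1)
  (T_contr : a_contraction a T) (b_gt : 1 - a < b) :
  let i := isometry_absent a T in
  let ii := forall x : H,
    (fun n => (cesaro_number (b + 1) n)^-1 *
       \sum_(0 <= j < n.+1) cesaro_number b (n - j)%N * hnorm (iter j T x) ^+ 2)
      @ \oo --> (0 : R) in
  let iii := forall x : H,
    limn_einf (fun n => (hnorm (iter n T x))%:E) = 0%E in
  (i <-> ii) /\ (ii <-> iii).
Proof.
move=> i ii iii.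
have b_gt0 : 0 < b by rewrite (lt_trans _ b_gt)// subr_gt0.
have i_ii : i -> ii.
  move=> [[M Mmin] /(_ M Mmin) W0] x; rewrite !cesaro_numberE.
  apply: (cvg_cesaro_mean_model a_gt0 a_lt1 b_gt (f := fun n => hnorm
    ((model_unitary M x).1 n) ^+ 2)).
    by move=> n; rewrite sqr_ge0.
  move=> j; apply: cvg_model_coef => //.
  have : [set: model_W M] (model_unitary M x).2 by [].
  by rewrite W0.
have ii_iii : ii -> iii.
  move=> mean x; apply/limn_einf_eq0P => [n|e e0 N]; first exact: hnorm_ge0.
  have := mean x; rewrite !cesaro_numberE => /(cesaro_mean_small b_gt0).
  have e2 : 0 < e ^+ 2 by rewrite exprn_gt0.
  move=> /(_ (fun n => sqr_ge0 _) _ e2 N)[n Nn qn]; exists n => //.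
  by rewrite -(ltr_pXn2r (_ : 0 < 2)%N) ?nnegrE ?hnorm_ge0 ?(ltW e0).
have iii_i : iii -> i.
  move=> inf0.
  have small x e : 0 < e -> exists n, hnorm (iter n T x) < e.
    move=> e0; have h := (limn_einf_eq0P (fun n => hnorm_ge0 (iter n T x))).1 (inf0 x).
    by have [n _ xn] := h e e0 0%N; exists n.
  split.
    have [D D_bounded DE] := defect_operator T_bounded a_gt0 a_lt1 T_contr.
    apply: (pure_shift_minimal_model H_separable a_gt0 D_bounded (T := T)) => x.
    apply: (@cvg_series_defect _ _ (fun n => hnorm (iter n T x) ^+ 2)) => //.
    - by move=> n; rewrite sqr_ge0.
    - by move=> n; rewrite sqr_ge0.
    - by move=> n; have := DE (iter n T x); under eq_fun do rewrite -iterD addnC.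
    - move=> e e0; have [|n xn] := small x (Num.sqrt e); first by rewrite sqrtr_gt0.
      exists n; rewrite -(sqr_sqrtr (ltW e0)).
      by rewrite ltr_pXn2r ?nnegrE ?hnorm_ge0 ?sqrtr_ge0.
  (* If W were not zero, {0} would be a proper closed invariant subspace containing every
     W-component, against minimality. *)
  move=> M [_ Wmin]; apply: contrapT => W0; apply: (Wmin [set (0 : model_W M)]) => //.
  - exact: closed_subspace0.
  - by move=> w ->; rewrite linear0.
  - by move=> h; apply: W0; rewrite h.
  - move=> u; rewrite -(model_unitary_range M) => -[x _ <-] /=.
    apply/eqP; rewrite -hnorm_eq0 eq_le hnorm_ge0 andbT.
    apply/ler_addgt0Pr => e /(small x)[n xn]; rewrite add0r.
    exact: le_trans (hnorm_model_W_le M a_gt0 x n) (ltW xn).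
by split; split=> // h; [exact/iii_i/ii_iii|exact/i_ii/iii_i].
Qed.
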